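(* Fix $t\in\mathbb{N}$ and a constant $B_t>0$ depending only on $t$. Let $t<n/2$ and let $x_1,\dots,x_F$ be real numbers with $\max_j|x_j|\le B_t/(2n-2)!!$ and $\sum_{j=1}^F x_j P_{\lambda^{(i)},\rho^{(j)}} = 1$ for $i=1$ and $=\zeta$ for $1<i\le F$. Then there is $G_t>0$ depending only on $t$ (and $B_t$) such that for every partition $\mu \vdash n$ that is not fat, the eigenvalue $\eta_\mu = \sum_{j=1}^F x_j P_{\mu,\rho^{(j)}}$ of $\sum_j x_j A_{\rho^{(j)}}$ on $S^{2\mu}$ satisfies \[|\eta_\mu| \le G_t|\zeta|/\sqrt{n} = o(|\zeta|).\]
   Context: $\mathcal{M}_{2n}$ is the set of perfect matchings of $K_{2n}$. For $m,m'\in\mathcal{M}_{2n}$ the multigraph union $m\cup m'$ is a disjoint union of even cycles (a common edge is a $2$-cycle); listing cycle lengths as $2\rho_1\ge2\rho_2\ge\dots$ gives the cycle type $d(m,m')=\rho\vdash n$. For $\rho \vdash n$ the associate $A_\rho$ is the 0/1 matrix indexed by $\mathcal{M}_{2n}$ with $(A_\rho)_{m,m'}=1$ iff $d(m,m')=\rho$. $\mathbb{R}[\mathcal{M}_{2n}]$ decomposes multiplicity-freely as $\bigoplus_{\lambda\vdash n} S^{2\lambda}$ (irreducible $S_{2n}$-modules indexed by $2\lambda=(2\lambda_1,2\lambda_2,\dots)$); $P_{\lambda,\rho}$ is the eigenvalue of $A_\rho$ on $S^{2\lambda}$. Partitions of $n$ are ordered reverse-lexicographically ($\mu\le\lambda$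 iff $\mu=\lambda$ or $\mu_j<\lambda_j$ at the first differing index $j$); $\lambda\vdash n$ is fat if $\lambda\ge(n-t,1^t)$ (equivalently the even partition $2\lambda$ is fat). $F_t$ is the number of fat partitions of $n$, $F=F_t-1$, and $\lambda^{(1)}>\dots>\lambda^{(F)}$, $\rho^{(1)}>\dots>\rho^{(F)}$ both denote the first $F$ partitions of $n$ in reverse-lexicographic order. $\zeta=-1/\big((2n-1)(2n-3)\cdots(2n-2t+1)-1\big)$ and $(2k)!!=2^kk!$. *)

(* Defs.v *)
From HB Require Import structures.
From mathcomp Require Import all_boot all_order all_algebra all_fingroup.
From mathcomp Require Import reals.
Set Implicit Arguments. Unset Strict Implicit. Unset Printing Implicit Defensive.
Import Order.TTheory GRing.Theory Num.Theory.

(* lexicographic strict order; for two partitions of the same n the first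
   differing index exists in both sequences *)
Fixpoint lexlt (a b : seq nat) : bool :=
  match a, b with
  | x :: s, y :: t => (x < y) || ((x == y) && lexlt s t)
  | _, _ => false
  end.
Definition lexle (mu lam : seq nat) : bool := (mu == lam) || lexlt mu lam.

Definition is_partition (n : nat) (s : seq nat) : bool :=
  [&& sorted geq s, all (fun a => 0 < a) s & sumn s == n].

(* generator: partitions of n with all parts <= k (fuel f >= n) *)
Fixpoint gen_parts (f k n : nat) : seq (seq nat) :=
  match f with
  | 0 => if n == 0 then [:: [::]] else [::]
  | f'.+1 =>
      if n == 0 then [:: [::]] else
      flatten [seq [seq a :: p | p <- gen_parts f' a (n - a)]
              | a <- rev (iota 1 (minn k n))]
  end.

Definition partitions (n : nat) : seq (seq nat) :=
  sort (fun a b => lexle b a) (undup (filter (is_partition n) (gen_parts n n n))).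

(* lambda^(i+1) (0-indexed) *)
Definition part_nth (n i : nat) : seq nat := nth [::] (partitions n) i.

Definition hook (n t : nat) : seq nat := (n - t) :: nseq t 1.
Definition fat (n t : nat) (lam : seq nat) : bool := lexle (hook n t) lam.
Definition Ft (n t : nat) : nat := count (fat n t) (partitions n).

(* ---------- perfect matchings of K_{2n} as fixed-point-free involutions ---------- *)

Definition is_pm (k : nat) (s : {perm 'I_k}) : bool :=
  [forall x, (s x != x) && (s (s x) == x)].

Definition matching (n : nat) := {s : {perm 'I_(2 * n)} | is_pm s}.

(* the connected components of the multigraph m U m' are the orbits of the
   group generated by the two involutions; cycle type: half the component
   sizes, sorted non-increasingly *)
Definition components n (m m' : matching n) : {set {set 'I_(2 * n)}} :=
  (orbit 'P <<[set val m; val m']>> @: [set: 'I_(2 * n)])%g.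
Definition dtype n (m m' : matching n) : seq nat :=
  sort geq [seq #|C| %/ 2 | C : {set 'I_(2 * n)} <- enum (components m m')].

Section Alg.
Variable R : realType.
Local Open Scope ring_scope.

Definition fvec n := {ffun matching n -> R}.

Definition assoc n (rho : seq nat) (f : fvec n) : fvec n :=
  [ffun m => \sum_(m' | dtype m m' == rho) f m'].

Definition mconj n (g : {perm 'I_(2 * n)}) (m : matching n) : matching n :=
  insubd m (val m ^ g)%g.
Definition pact n (g : {perm 'I_(2 * n)}) (f : fvec n) : fvec n :=
  [ffun m => f (mconj g^-1 m)].

(* Young tableau of shape sh filled row by row with 0..|sh|-1 *)
Fixpoint rowof (sh : seq nat) (k : nat) : nat :=
  match sh with [::] => 0 | a :: s => if (k < a)%N then 0%N else (rowof s (k - a)%N).+1 end.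
Fixpoint colof (sh : seq nat) (k : nat) : nat :=
  match sh with [::] => k | a :: s => if (k < a)%N then k else colof s (k - a)%N end.

Definition row_perm n (sh : seq nat) (p : {perm 'I_(2 * n)}) : bool :=
  [forall x, rowof sh (p x) == rowof sh x].
Definition col_perm n (sh : seq nat) (q : {perm 'I_(2 * n)}) : bool :=
  [forall x, colof sh (q x) == colof sh x].

Definition young n (sh : seq nat) (f : fvec n) : fvec n :=
  [ffun m => \sum_(p | row_perm sh p) \sum_(q | col_perm sh q)
     ((-1) ^+ odd_perm q) * pact p (pact q f) m].

(* the S^{2 lambda}-isotypic component of R[M_2n]: the image of the two-sided
   ideal generated by the Young symmetrizer, i.e. span { g e_T v } *)
Definition double (lam : seq nat) : seq nat := [seq 2 * a | a <- lam].
Definition in_component n (lam : seq nat) (w : fvec n) : Prop :=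
  exists v : {perm 'I_(2 * n)} -> fvec n,
    forall m, w m = \sum_g pact g (young (double lam) (v g)) m.

Definition is_eigen_table n (P : seq nat -> seq nat -> R) : Prop :=
  forall lam rho, lam \in partitions n -> rho \in partitions n ->
    forall w : fvec n, in_component lam w -> forall m, assoc rho w m = P lam rho * w m.

Definition dfact2 (k : nat) : nat := 2 ^ k * k`!.

Definition zeta (n t : nat) : R :=
  - (((\prod_(1 <= k < t.+1) (2 * n - 2 * k + 1)%N)%:R - 1) ^-1).

End Alg.

(* Main.v *)
(** Let [T] be the matrix of [sum_j x_j A_(rho_j)] and [eta] its eigenvalue on the
    component of [mu].  By Bessel's inequality applied to the rows of [T], any [D]
    orthogonal nonzero vectors of that component give
    [D eta^2 <= sum_(m, m') T m m' ^ 2].  On the right, an entry is nonzero only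
    if the union of the two matchings has a cycle of length at least [2 (n - t)];
    exploring such a cycle from one of [2 t + 1] fixed vertices shows that each row
    has [O((2n-2)!!)] nonzero entries, so the right-hand side is [O(n)].  It remains
    to find [D >= c n^k] orthogonal vectors, with [k = 2 t + 2].

    These are translates of one nonzero vector [w] of the component that is
    antisymmetric under [k] transpositions and symmetric under [k] others, all
    disjoint: refining [w] to a joint sign vector for the [n] transpositions
    [(2i, 2i+1)], distinct sign patterns are orthogonal and there are
    [binomial n a] of them for some [a] between [k] and [n - k].  As [mu] is not
    fat, [2 mu] has at least [k] cells below its first row.  If the first row of [2 mu] is
    long, [w] is the product of [1 - (x_i y_i)], for [x_i] below and [y_i] in the
    first row, applied to the image [u] of the Young symmetrizer; [w] is nonzero
    because Garnir-type relations make [(-1)^j <(x_1 y_1)...(x_j y_j) u, u>] a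
    positive multiple of [<s u, u> >= 0], [s] being the symmetrizer of
    [x_1, ..., x_j].  If the first row is short, there are many rows, and [w] is
    obtained from a column-antisymmetric vector by symmetrizing along some rows. *)

Require Import Defs.
From HB Require Import structures.
From mathcomp Require Import all_boot all_order all_algebra all_fingroup.
From mathcomp Require Import reals zify ring lra.
Set Implicit Arguments. Unset Strict Implicit. Unset Printing Implicit Defensive.
Import Order.TTheory GRing.Theory Num.Theory.

(** * Counting matchings that create a long cycle *)

(** The double factorial $(2k-1)!!$, the number of perfect matchings of $K_{2k}$. *)
Definition odfact (k : nat) : nat := \prod_(i < k) (2 * i + 1).

Lemma odfactS k : odfact k.+1 = odfact k * (2 * k + 1).
Proof. by rewrite /odfact big_ord_recr. Qed.

Lemma dfact2S k : dfact2 k.+1 = dfact2 k * (2 * k + 2).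
Proof. by rewrite /dfact2 factS expnS; lia. Qed.

Lemma dfact2_gt0 k : 0 < dfact2 k.
Proof. by rewrite /dfact2 muln_gt0 expn_gt0 fact_gt0. Qed.

Lemma odfact_le_dfact2 k : odfact k <= dfact2 k.
Proof.
elim: k => [|k IH]; first by rewrite /odfact big_ord0.
by rewrite odfactS dfact2S leq_mul // leq_add2l.
Qed.

Lemma odfact_mono k l : k <= l -> odfact k <= odfact l.
Proof.
move=> /subnK <-; elim: (l - k) => // d IH.
by rewrite addSn odfactS (leq_trans IH) // leq_pmulr // addn1.
Qed.

Section Counting.
Variable n : nat.
Local Notation T := 'I_(2 * n).
Implicit Types (m s : matching n) (A : {set T}) (X : {set matching n}).

Lemma pmK m : involutive (val m).
Proof. by move=> x; case: m => s /= /forallP/(_ x)/andP[_ /eqP]. Qed.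

Lemma pm_neq m x : val m x != x.
Proof. by case: m => s /= /forallP/(_ x)/andP[]. Qed.

(** State of an exploration: the matchings in [X] agree outside [A] and match [A] within itself, so
    only their edges inside [A] are still unknown. *)
Definition coherent A X :=
  [forall s in X, forall x, (val s x \in A) == (x \in A)] /\
  (forall s s' x, s \in X -> s' \in X -> x \notin A -> val s x = val s' x).

Lemma coherent_stab A X s x : coherent A X -> s \in X ->
  (val s x \in A) = (x \in A).
Proof. by case=> /forall_inP H _ /H/forallP/(_ x)/eqP. Qed.

Lemma coherent_fiber A X y b : coherent A X -> y \in A ->
  coherent (A :\ y :\ b) [set s in X | val s y == b].
Proof.
move=> H Ay; split.
  apply/forall_inP => s; rewrite inE => /andP[sX /eqP syb].
  have sby : val s b = y by rewrite -syb pmK.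
  apply/forallP => x; rewrite !inE (coherent_stab x H sX).
  apply/eqP; have [->|xy] := eqVneq x y; first by rewrite syb eqxx /= andbF.
  have [->|xb] := eqVneq x b; first by rewrite sby eqxx /= andbF.
  have -> : val s x == b = false.
    by apply/negbTE; rewrite -syb (inj_eq perm_inj).
  by have -> : val s x == y = false by apply/negbTE; rewrite -sby (inj_eq perm_inj).
move=> s s' x; rewrite !inE => /andP[sX /eqP syb] /andP[s'X /eqP syb'].
have [->|xy] := eqVneq x y; first by rewrite syb syb'.
have [->|xb] := eqVneq x b; first by transitivity y; [rewrite -syb pmK | rewrite -syb' pmK].
by move=> /= xA; case: H => _; apply.
Qed.

Lemma card_fibers A X y : coherent A X -> y \in A ->
  #|X| = \sum_(b in A :\ y) #|[set s in X | val s y == b]|.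
Proof.
move=> H Ay; rewrite -sum1_card.
rewrite (partition_big (fun s : matching n => val s y) [in A :\ y]) /=; last first.
  by move=> s sX; rewrite !inE pm_neq (coherent_stab _ H sX).
by apply: eq_bigr => b _; rewrite -sum1_card; apply: eq_bigl => s; rewrite inE.
Qed.

Lemma card_fiberset A y b k : #|A| = 2 * k.+1 -> y \in A -> b \in A :\ y ->
  #|A :\ y :\ b| = 2 * k.
Proof. by move=> cA Ay Ab; have := cardsD1 y A; have := cardsD1 b (A :\ y); rewrite Ay Ab; lia. Qed.

(** Revealing the partner of one point among $2k+2$ leaves $2k+1$ choices, each giving a coherent
    family on $2k$ points. *)
Lemma card_coherent k A X : #|A| = 2 * k -> coherent A X -> #|X| <= odfact k.
Proof.
elim: k A X => [|k IH] A X cA H.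
  have A0 : A = set0 by apply/eqP; rewrite -cards_eq0 cA.
  rewrite /odfact big_ord0; apply/card_le1_eqP => s s' sX s'X.
  by apply/val_inj/permP => x; case: H => _; apply=> //; rewrite A0 inE.
have [y Ay] : exists y, y \in A by apply/card_gt0P; rewrite cA.
rewrite (card_fibers H Ay).
apply: (@leq_trans (\sum_(b in A :\ y) odfact k)).
  apply: leq_sum => b bA; apply: IH (coherent_fiber b H Ay).
  exact: card_fiberset cA Ay bA.
rewrite sum_nat_const odfactS mulnC leq_mul2l.
by have := cardsD1 y A; rewrite Ay; lia.
Qed.

Lemma card_matching : #|{: matching n}| <= odfact n.
Proof.
rewrite -cardsT; apply: (@card_coherent _ setT); first by rewrite cardsT card_ord.
by split; [apply/forall_inP => s _; apply/forallP => x; rewrite !inE | move=> s s' x _ _; rewrite inE].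
Qed.

Variable m : matching n.

Definition comp_of s x := orbit 'P <<[set val m; val s]>>%g x.

Lemma comp_sub s x (V : {set T}) : x \in V ->
  (forall z, z \in V -> val m z \in V) -> (forall z, z \in V -> val s z \in V) ->
  comp_of s x \subset V.
Proof.
move=> xV mV sV; rewrite /comp_of acts_sub_orbit //.
rewrite gen_subG subUset !sub1set !inE /=.
by apply/andP; split; apply/subsetP => z zV; rewrite inE /= ?mV ?sV.
Qed.

(* The points outside [A], together with [x] and [y], form the explored arc of
   the cycle through [x]; its two ends [x] and [y] still await their partner. *)
Lemma card_explore t k A X x y : #|A| = 2 * k.+1 -> coherent A X ->
  x \in A -> y \in A :\ x ->
  (forall z, z \in A :\ x :\ y -> val m z \in A :\ x :\ y) ->
  (forall s, s \in X -> 2 * n <= #|comp_of s x| + 2 * t) ->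
  #|X| <= odfact t.+1 * dfact2 k.
Proof.
elim: k A X y => [|k IH] A X y cA H Ax yAx mA big.
  rewrite (leq_trans (card_coherent cA H)) // (leq_trans (odfact_mono (_ : 1 <= t.+1))) //.
  by rewrite leq_pmulr ?dfact2_gt0.
have Ay : y \in A by move: yAx; rewrite inE => /andP[].
have yx : y != x by move: yAx; rewrite !inE => /andP[].
(* With at most $2(t+1)$ points in [A], counting all matchings of [A] suffices. *)
have [kt|tk] := leqP k.+2 t.+1.
  rewrite (leq_trans (card_coherent cA H)) // (leq_trans (odfact_mono kt)) //.
  by rewrite leq_pmulr ?dfact2_gt0.
rewrite (card_fibers H Ay).
have xAy : x \in A :\ y by rewrite !inE eq_sym yx.
rewrite (bigD1 x) //=.
(* If [s] joins [y] to [x], the cycle closes inside the explored arc and has fewer than $2(n-t)$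
   points. Losing this choice leaves $2k+2$ instead of $2k+3$, which builds up [dfact2]. *)
have -> : #|[set s in X | val s y == x]| = 0.
  apply: eq_card0 => s; rewrite !inE; apply/negP => /andP[sX /eqP syx].
  have sxy : val s x = y by rewrite -syx pmK.
  have sub : comp_of s x \subset ~: (A :\ x :\ y).
    apply: comp_sub; first by rewrite !inE eqxx /= andbF.
      by move=> z; rewrite !in_setC; apply: contra => /mA; rewrite pmK.
    move=> z; rewrite !inE !negb_and !negbK (coherent_stab z H sX).
    have [->|zy] := eqVneq z y; first by rewrite syx eqxx orbT.
    have [->|zx] := eqVneq z x; first by rewrite sxy eqxx.
    by move=> /= ->; rewrite !orbT.
  have := subset_leq_card sub; have := big s sX; have := cardsC (A :\ x :\ y); rewrite card_ord.
  by have := card_fiberset cA Ax yAx; lia.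
rewrite add0n.
apply: (@leq_trans (\sum_(b in A :\ y :\ x) odfact t.+1 * dfact2 k)).
  rewrite [leqLHS](eq_bigl [in A :\ y :\ x]); last by move=> b; rewrite !inE andbC.
  apply: leq_sum => b; rewrite !inE => /and3P[bx byy bA].
  have bAy : b \in A :\ y by rewrite !inE byy.
  have : val m b \in A :\ x :\ y by apply: mA; rewrite !inE byy bx.
  rewrite !inE => /and3P[mby mbx mbA].
  (* The arc grows by the edge from [y] to [b] and the edge of [m] at [b], whose far end is the new
     open end. *)
  apply: (IH (A :\ y :\ b) _ (val m b)).
  - exact: card_fiberset cA Ay bAy.
  - exact: coherent_fiber.
  - by rewrite !inE Ax eq_sym bx eq_sym yx.
  - by rewrite !inE mbA mby mbx pm_neq.
  - move=> z; rewrite !inE => /and5P[zmb zx zb zy zA].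
    have : val m z \in A :\ x :\ y by apply: mA; rewrite !inE zy zx.
    rewrite !inE => /and3P[-> -> ->].
    by rewrite (inj_eq perm_inj) zb /= andbT -[b in _ != b](pmK m b) (inj_eq perm_inj).
  - by move=> s; rewrite inE => /andP[/big].
rewrite sum_nat_const dfact2S (card_fiberset cA Ay xAy) mulnC -mulnA !leq_mul2l; lia.
Qed.

Lemma card_big_at t x :
  #|[set s | 2 * n <= #|comp_of s x| + 2 * t]| <= odfact t.+1 * dfact2 n.-1.
Proof.
have n0 : 0 < n by case: x => i; lia.
apply: (@card_explore t n.-1 setT _ x (val m x)).
- by rewrite cardsT card_ord; lia.
- by split; [apply/forall_inP => s _; apply/forallP => z; rewrite !inE | move=> s s' z _ _; rewrite inE].
- by rewrite inE.
- by rewrite !inE pm_neq.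
- move=> z; rewrite !inE => /and3P[zmx zx _].
  by rewrite (inj_eq perm_inj) zx /= -[x in _ != x](pmK m x) (inj_eq perm_inj) zmx.
- by move=> s; rewrite inE.
Qed.

(* A component with at least [2 (n - t)] vertices meets any set of [2 t + 1] vertices. *)
Lemma card_big_comp t : 2 * t < n ->
  #|[set s | has (fun c => n - t <= c) (dtype m s)]|
    <= (2 * t).+1 * (odfact t.+1 * dfact2 n.-1).
Proof.
move=> tn; have H : (2 * t).+1 <= 2 * n by lia.
pose Xt (i : 'I_(2 * t).+1) := [set s | 2 * n <= #|comp_of s (widen_ord H i)| + 2 * t].
apply: (@leq_trans #|\bigcup_i Xt i|); last first.
  apply: (@leq_trans (\sum_(i < (2 * t).+1) #|Xt i|)).
    by apply: (big_ind2 (fun (A : {set _}) a => #|A| <= a)); rewrite ?cards0 // => A a C c /= hA hC;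
      rewrite (leq_trans (leq_card_setU _ _)) // leq_add.
  apply: (leq_trans (leq_sum _ (fun i _ => card_big_at t (widen_ord H i)))).
  by rewrite sum_nat_const card_ord.
apply/subset_leq_card/subsetP => s; rewrite inE => /hasP[c].
rewrite mem_sort => /mapP[C]; rewrite mem_enum => /imsetP[x _ ->] -> big.
have {}big : 2 * (n - t) <= #|comp_of s x| by rewrite mulnC -leq_divRL.
pose Q := [set widen_ord H i | i : 'I_(2 * t).+1].
have cQ : #|Q| = (2 * t).+1.
  by rewrite card_imset ?card_ord // => i j /(congr1 val) /= /val_inj.
have [z] : exists z, z \in comp_of s x :&: Q.
  apply/card_gt0P; rewrite -(ltn_add2l #|comp_of s x :|: Q|) addn0 cardsUI cQ.
  by apply: leq_ltn_trans (max_card _) _; rewrite card_ord; lia.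
rewrite inE => /andP[zO /imsetP[i _ zi]].
apply/bigcupP; exists i => //; rewrite inE -zi.
have -> : comp_of s z = comp_of s x by apply/eqP; rewrite orbit_eq_mem.
by lia.
Qed.

End Counting.

(** * Partitions in reverse-lexicographic order *)

Lemma lexlt_trans : transitive lexlt.
Proof.
move=> b a; elim: a b => [|x a IH] [|y b] [|z c] //=.
move=> /orP[xy|/andP[/eqP-> ab]] /orP[yz|/andP[/eqP<- bc]].
- by rewrite (ltn_trans xy yz).
- by rewrite xy.
- by rewrite yz.
- by rewrite eqxx (IH _ _ ab bc) orbT.
Qed.

Lemma lexle_trans : transitive lexle.
Proof.
move=> b a c /orP[/eqP->//|ab] /orP[/eqP<-|bc]; rewrite /lexle ?ab ?orbT //.
by rewrite (lexlt_trans ab bc) orbT.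
Qed.

(** [lexlt] fails to compare distinct sequences only if one is a prefix of the other; positive
    entries with equal sums exclude this. *)
Lemma lexlt_total_pos a b : all (leq 1) a -> all (leq 1) b -> sumn a = sumn b ->
  [|| a == b, lexlt a b | lexlt b a].
Proof.
elim: a b => [|x a IH] [|y b] //=; try lia.
move=> /andP[x0 a0] /andP[y0 b0] e.
case: ltngtP => //= [_|_|xy]; rewrite ?orbT //.
by have := IH b a0 b0; rewrite xy eqseq_cons eqxx => -> //; lia.
Qed.

Lemma partition_sum n s : is_partition n s -> sumn s = n.
Proof. by case/and3P => _ _ /eqP. Qed.

Lemma partition_pos n s : is_partition n s -> all (leq 1) s.
Proof. by case/and3P. Qed.

Lemma lexle_total n : {in is_partition n &, total lexle}.
Proof.
move=> a b pa pb; rewrite /lexle (eq_sym b a).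
have := lexlt_total_pos (partition_pos pa) (partition_pos pb).
rewrite (partition_sum pa) (partition_sum pb) => /(_ erefl).
by case: (a == b).
Qed.

Lemma mem_partitions n s : s \in partitions n -> is_partition n s.
Proof. by rewrite mem_sort mem_undup mem_filter => /andP[]. Qed.

Lemma partitions_uniq n : uniq (partitions n).
Proof. by rewrite sort_uniq undup_uniq. Qed.

Lemma partitions_sorted n : sorted (fun a b => lexle b a) (partitions n).
Proof.
apply: (sort_sorted_in (P := is_partition n)).
  by move=> a b pa pb; apply: (@lexle_total n b a pb pa).
by apply/allP => s; rewrite mem_undup mem_filter => /andP[].
Qed.

(** Since [p] passes to earlier entries, those satisfying it form an initial segment, whose length
    is the count. *)
Lemma nth_sorted_count (T : Type) (x0 : T) (r : rel T) (p : pred T) s j :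
  transitive r -> (forall a b, r a b -> p b -> p a) -> sorted r s ->
  j < count p s -> p (nth x0 s j).
Proof.
move=> rT rp; elim: s j => [|x s IH] // j /= srt.
have [px|npx] := boolP (p x).
  by case: j => [|j] //= js; apply: IH; rewrite ?(path_sorted srt).
suff -> : count p s = 0 by [].
apply/eqP; rewrite -leqn0 leqNgt -has_count; apply/negP => hp.
move: (order_path_min rT srt) hp; elim: s {IH srt} => //= y s IH /andP[xy xs].
by move=> /orP[/(rp _ _ xy)|/(IH xs)] //; rewrite (negbTE npx).
Qed.

Lemma fat_part_nth n t j : j < Ft n t -> fat n t (part_nth n j).
Proof.
apply: nth_sorted_count (partitions_sorted n).
  by move=> b a c ba cb; apply: lexle_trans cb ba.
by move=> a b ba hb; apply: lexle_trans hb ba.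
Qed.

Lemma part_nth_mem n t j : j < Ft n t -> part_nth n j \in partitions n.
Proof. by move=> jF; apply: mem_nth; apply: leq_trans jF (count_size _ _). Qed.

Lemma part_nth_inj n t i j : i < Ft n t -> j < Ft n t ->
  part_nth n i = part_nth n j -> i = j.
Proof.
have S k : k < Ft n t -> k < size (partitions n).
  by move=> kF; apply: leq_trans kF (count_size _ _).
by move=> /S iF /S jF /eqP; rewrite nth_uniq ?partitions_uniq // => /eqP.
Qed.

Lemma fat_has n t lam : fat n t lam -> has (fun c => n - t <= c) lam.
Proof.
case: lam => [|a s] //=; rewrite /fat /lexle /hook eqseq_cons /=.
by case/orP => [/andP[/eqP-> _]|/orP[/ltnW->|/andP[/eqP-> _]]] //; rewrite leqnn.
Qed.

Lemma lexle_nseq1 t s : all (leq 1) s -> sumn s = t -> lexle (nseq t 1) s.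
Proof.
elim: s t => [|a s IH] [|t] //=; try lia.
case: a => [|[|a]] //= /IH{}IH [/IH]; rewrite /lexle /= eqseq_cons eqxx //.
Qed.

(** A first part equal to [n - t] already suffices for fatness: the rest is then a partition of [t],
    and $1^t$ is the least of these. *)
Lemma not_fat_head n t mu : t < n -> mu \in partitions n -> ~~ fat n t mu ->
  head 0 mu < n - t.
Proof.
move=> tn /mem_partitions pm; rewrite ltnNge; apply: contra.
case: mu pm => [|a s] /=; first by move=> _; lia.
move=> pm; rewrite /fat /hook leq_eqVlt => /orP[/eqP e|lt]; last first.
  by rewrite /lexle /= lt orbT.
subst a; rewrite /lexle /= eqseq_cons eqxx ltnn -/(lexle _ _).
apply: lexle_nseq1; first by case/andP: (partition_pos pm).
by have := partition_sum pm; move=> /=; lia.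
Qed.

(** For $t=0$ only $(n)$ is fat, so sums over [(Ft n 0).-1] indices are empty. *)
Lemma Ft0 n : 0 < n -> Ft n 0 <= 1.
Proof.
move=> n0; rewrite /Ft (@eq_in_count _ _ (pred1 [:: n])).
  by rewrite count_uniq_mem ?partitions_uniq // leq_b1.
move=> s /mem_partitions ps; rewrite /fat /hook /lexle subn0 /= [LHS]orbC eq_sym.
case: s ps => [|a s] //= ps; have := partition_sum ps => /= e.
by have -> : n < a = false by [lia]; rewrite andbF.
Qed.

(** * The permutation action on functions of matchings *)

Lemma val_mconj n (g : {perm 'I_(2 * n)}) (m : matching n) :
  val (mconj g m) = (val m ^ g)%g.
Proof.
rewrite val_insubd; case: ifP => // /negP[]; apply/forallP => x.
by rewrite -(permKV g x) !permJ (inj_eq perm_inj) pm_neq pmK eqxx.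
Qed.

Lemma mconjM n (g h : {perm 'I_(2 * n)}) (m : matching n) :
  mconj h (mconj g m) = mconj (g * h)%g m.
Proof. by apply: val_inj; rewrite !val_mconj conjgM. Qed.

Lemma mconj1 n (m : matching n) : mconj 1%g m = m.
Proof. by apply: val_inj; rewrite val_mconj conjg1. Qed.

Section Rep.
Local Open Scope ring_scope.
Variables (R : realType) (n : nat).
Local Notation T := 'I_(2 * n).
(* [fvec R n] up to conversion; [R^o] provides the module structure. *)
Definition mvec := {ffun matching n -> R^o}.
HB.instance Definition _ := GRing.Lmodule.on mvec.
Local Notation V := mvec.
Implicit Types (f u w : V) (g h p : {perm T}) (H : {group {perm T}}) (e : bool).

Definition pmact g f : V := [ffun m => f (mconj g^-1 m)].

Fact pmact_is_linear g : linear (pmact g).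
Proof. by move=> a f f'; apply/ffunP => m; rewrite !ffunE. Qed.
HB.instance Definition _ g := GRing.isLinear.Build R V V *:%R (pmact g) (pmact_is_linear g).

(** Permutations multiply from left to right, so [h * g] acts by [h] first. *)
Lemma pmactM g h f : pmact g (pmact h f) = pmact (h * g) f.
Proof. by apply/ffunP => m; rewrite !ffunE mconjM invMg. Qed.

Lemma pmact1 f : pmact 1 f = f.
Proof.
by apply/ffunP => m; rewrite ffunE invg1 mconj1.
Qed.

Lemma pmactK g : cancel (pmact g) (pmact g^-1).
Proof. by move=> f; rewrite pmactM mulgV pmact1. Qed.

Definition dot f w : R := \sum_m f m * w m.

Lemma dotC f w : dot f w = dot w f.
Proof. by apply: eq_bigr => m _; rewrite mulrC. Qed.

Fact dot_is_linear f : linear (dot f : V -> R^o).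
Proof.
move=> a w w'; rewrite /dot scaler_sumr -big_split; apply: eq_bigr => m _.
by rewrite !ffunE mulrDr; congr (_ + _); rewrite /GRing.scale /= mulrCA.
Qed.
HB.instance Definition _ f :=
  GRing.isLinear.Build R V R^o *:%R (dot f : V -> R^o) (dot_is_linear f).

Lemma dotDr f w w' : dot f (w + w') = dot f w + dot f w'. Proof. exact: linearD. Qed.
Lemma dotDl f w w' : dot (w + w') f = dot w f + dot w' f.
Proof. by rewrite dotC dotDr !(dotC f). Qed.
Lemma dotZr f a w : dot f (a *: w) = a * dot f w. Proof. exact: linearZ. Qed.
Lemma dotZl f a w : dot (a *: w) f = a * dot w f.
Proof. by rewrite dotC dotZr dotC. Qed.
Lemma dot_sumr f I r (P : pred I) (F : I -> V) :
  dot f (\sum_(i <- r | P i) F i) = \sum_(i <- r | P i) dot f (F i).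
Proof. exact: (linear_sum (dot f : V -> R^o)). Qed.
Lemma dot_suml f I r (P : pred I) (F : I -> V) :
  dot (\sum_(i <- r | P i) F i) f = \sum_(i <- r | P i) dot (F i) f.
Proof. by rewrite dotC dot_sumr; apply: eq_bigr => i _; rewrite dotC. Qed.

Lemma dot_ge0 f : 0 <= dot f f.
Proof. by apply: sumr_ge0 => m _; rewrite -expr2 sqr_ge0. Qed.

Lemma dot_eq0 f : (dot f f == 0) = (f == 0).
Proof.
apply/eqP/eqP => [H|->]; last by rewrite /dot big1 // => m _; rewrite ffunE mul0r.
apply/ffunP => m; rewrite ffunE; apply/eqP; rewrite -sqrf_eq0 expr2; apply/eqP.
by move: m isT; apply/psumr_eq0P => // m _; rewrite -expr2 sqr_ge0.
Qed.

Lemma dot_gt0 f : (0 < dot f f) = (f != 0).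
Proof. by rewrite lt_def dot_ge0 dot_eq0 andbT. Qed.

Lemma dot_pmact g f w : dot (pmact g f) (pmact g w) = dot f w.
Proof.
rewrite /dot (reindex_inj (h := mconj g)) /=.
  by apply: eq_bigr => m _; rewrite !ffunE mconjM mulgV mconj1.
by apply: (can_inj (g := mconj g^-1)) => m; rewrite mconjM mulgV mconj1.
Qed.

Lemma dot_pmactl g f w : dot (pmact g f) w = dot f (pmact g^-1 w).
Proof. by rewrite -(dot_pmact g^-1) pmactK. Qed.

(** The symmetrizer of [H] for [e = false], the antisymmetrizer for [e = true]. *)
Definition gsym e (H : {set {perm T}}) f : V :=
  \sum_(p in H) (-1) ^+ (e && odd_perm p) *: pmact p f.

Fact gsym_is_linear e (H : {set {perm T}}) : linear (gsym e H).
Proof.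
move=> a f f'; rewrite /gsym scaler_sumr -big_split; apply: eq_bigr => p _ /=.
by rewrite linearP scalerDr !scalerA mulrC.
Qed.
HB.instance Definition _ e (H : {set {perm T}}) :=
  GRing.isLinear.Build R V V *:%R (gsym e H) (gsym_is_linear e H).

Let chi e p : R := (-1) ^+ (e && odd_perm p).
Let chiM e p q : chi e (p * q) = chi e p * chi e q.
Proof. by rewrite /chi; case: e => /=; rewrite ?mulr1 // odd_permM signr_addb. Qed.
Let chiV e p : chi e p^-1 = chi e p.
Proof. by rewrite /chi odd_permV. Qed.
Let chi2 e p : chi e p * chi e p = 1.
Proof. by rewrite -signr_addb addbb. Qed.

Lemma pmact_gsym e H h f : h \in H ->
  pmact h (gsym e H f) = (-1) ^+ (e && odd_perm h) *: gsym e H f.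
Proof.
move=> hH; rewrite /gsym linear_sum scaler_sumr /= (reindex_inj (mulIg h^-1)%g) /=.
apply: eq_big => [p|p _]; first by rewrite groupMr ?groupV.
rewrite linearZ /= pmactM mulgKV scalerA -/(chi e _) -/(chi e _) -/(chi e p) chiM chiV.
by rewrite mulrC.
Qed.

Lemma gsym_pmact e H h f : h \in H ->
  gsym e H (pmact h f) = (-1) ^+ (e && odd_perm h) *: gsym e H f.
Proof.
move=> hH; rewrite /gsym scaler_sumr /= (reindex_inj (mulgI h^-1)%g) /=.
apply: eq_big => [p|p _]; first by rewrite groupMl ?groupV.
by rewrite pmactM mulKVg scalerA -/(chi e _) -/(chi e _) -/(chi e p) chiM chiV.
Qed.

Lemma gsym_id e H f : (forall h, h \in H -> pmact h f = (-1) ^+ (e && odd_perm h) *: f) ->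
  gsym e H f = #|H|%:R *: f.
Proof.
move=> Hf; rewrite /gsym (eq_bigr (fun=> f)) => [|p pH].
  by rewrite sumr_const scaler_nat.
by rewrite Hf // scalerA -/(chi e p) chi2 scale1r.
Qed.

Lemma gsym_gsym e H f : gsym e H (gsym e H f) = #|H|%:R *: gsym e H f.
Proof. by apply: gsym_id => h hH; rewrite pmact_gsym. Qed.

Lemma gsym_adj e H f w : dot (gsym e H f) w = dot f (gsym e H w).
Proof.
rewrite /gsym dot_suml dot_sumr (reindex_inj invg_inj) /=.
apply: eq_big => [p|p _]; first by rewrite groupV.
by rewrite dotZl dotZr dot_pmactl invgK odd_permV.
Qed.

(** [gsym e H] is [#|H|] times an orthogonal projection. *)
Lemma dot_gsym e H f w : #|H|%:R * dot (gsym e H f) w = dot (gsym e H f) (gsym e H w).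
Proof. by rewrite -gsym_adj gsym_gsym dotZl. Qed.

Lemma dot_gsym_ge0 e H f : 0 <= dot (gsym e H f) f.
Proof.
by rewrite -(pmulr_rge0 _ (_ : 0 < #|H|%:R)) ?ltr0n ?cardG_gt0 // dot_gsym dot_ge0.
Qed.

Lemma gsym_neq0 e H f w : dot (gsym e H f) (gsym e H w) != 0 -> dot (gsym e H f) w != 0.
Proof. by rewrite -dot_gsym mulf_eq0 negb_or => /andP[]. Qed.

End Rep.

(** * The Young symmetrizer does not vanish *)

Definition partner (k : nat) : nat := if odd k then k.-1 else k.+1.

Lemma partnerK : involutive partner.
Proof. by move=> k; rewrite /partner; case: ifP; case: ifP; lia. Qed.

(** Rows have even length, so each begins at an even index and $2i$, $2i+1$ occupy neighbouring
    cells of one row. *)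
Lemma cell_partner sh k : all (fun a => ~~ odd a) sh ->
  [/\ rowof sh (partner k) = rowof sh k, colof sh (partner k) = partner (colof sh k)
    & odd (colof sh k) = odd k].
Proof.
elim: sh k => [|a sh IH] k //= /andP[ea /IH{}IH].
have -> : (partner k < a) = (k < a) by rewrite /partner; case: ifP; lia.
case: ltnP => // ka; have [<- <- o] := IH (k - a).
have -> : partner k - a = partner (k - a) by rewrite /partner oddB // (negbTE ea) addbF; case: ifP; lia.
by split; rewrite // o oddB // (negbTE ea) addbF.
Qed.

Lemma cell_inj sh k l : rowof sh k = rowof sh l -> colof sh k = colof sh l -> k = l.
Proof.
elim: sh k l => [|a sh IH] k l //=; case: ltnP => ka; case: ltnP => la //= [].
by move=> /IH{}IH /IH; lia.
Qed.

Lemma colof_lt sh a k : all (geq a) sh -> k < sumn sh -> colof sh k < a.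
Proof.
elim: sh k => [|b sh IH] k //= /andP[ba /IH{}IH] ks.
by case: (ltnP k b) => kb; [apply: leq_trans kb ba | apply: IH; lia].
Qed.

(** * Stabilizers of the levels of a function, covering rows and columns of a tableau *)

Section LevelGroup.
Variables (T : finType) (c : T -> nat).

Definition level_set : {set {perm T}} := [set p : {perm T} | [forall x, c (p x) == c x]].

Lemma level_setP (p : {perm T}) : reflect (forall x, c (p x) = c x) (p \in level_set).
Proof. by rewrite inE; apply: (iffP forallP) => H x; apply/eqP. Qed.

Fact level_group_set : group_set level_set.
Proof.
apply/group_setP; split; first by apply/level_setP => x; rewrite perm1.
by move=> p q /level_setP hp /level_setP hq; apply/level_setP => x; rewrite permM hq hp.
Qed.
Canonical level_group := Group level_group_set.

Lemma tperm_level (x y : T) : c x = c y -> tperm x y \in level_set.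
Proof. by move=> e; apply/level_setP => z; case: tpermP => [->|->|]. Qed.

End LevelGroup.

(** * The matching with edges $\{2i,2i+1\}$ *)

Section Base.
Variable n : nat.
Local Notation T := 'I_(2 * n).

Fact partner_ord_subproof (x : T) : partner x < 2 * n.
Proof. by case: x => k /=; rewrite /partner; case: ifP; lia. Qed.

Definition partner_ord (x : T) : T := Ordinal (partner_ord_subproof x).

Lemma partner_ordK : involutive partner_ord.
Proof. by move=> x; apply: val_inj; rewrite /= partnerK. Qed.

Fact base_is_pm : is_pm (perm (inv_inj partner_ordK)).
Proof.
apply/forallP => x; rewrite !permE partner_ordK eqxx andbT -val_eqE /= /partner.
by case: ifP; lia.
Qed.

Definition base_matching : matching n := Sub _ base_is_pm.

Lemma base_matchingE x : val base_matching x = partner_ord x.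
Proof. by rewrite /= permE. Qed.

(* [q] splits into its actions on even and on odd points, which are conjugate
   under the base matching and so have the same sign. *)
Lemma even_perm_commute_base (q : {perm T}) :
  (forall x, odd (q x) = odd x) ->
  (forall x, q (partner_ord x) = partner_ord (q x)) -> odd_perm q = false.
Proof.
move=> par qm; have inj : injective (fun x : T => if odd x then x else q x).
  move=> x y /=; case: ifP => ox; case: ifP => oy // e.
  - by move: ox; rewrite e par oy.
  - by move: oy; rewrite -e par ox.
  - exact: perm_inj e.
pose qe := perm inj; pose mu := val base_matching.
suff -> : q = (qe * qe ^ mu)%g by rewrite odd_permM odd_permJ addbb.
have op (x : T) : odd (partner_ord x) = ~~ odd x by rewrite /= /partner; case: ifP; lia.
have qmu y : (qe ^ mu)%g (partner_ord y) = partner_ord (qe y).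
  by rewrite -!base_matchingE permJ.
apply/permP => x; rewrite permM [qe x]permE; case: ifP => ox; last first.
  by rewrite -[in RHS](partner_ordK (q x)) qmu [qe _]permE op par ox partner_ordK.
by rewrite -[in RHS](partner_ordK x) qmu [qe _]permE op ox -qm partner_ordK.
Qed.

End Base.

Section Young.
Variables (R : realType) (n : nat) (sh : seq nat).
Hypothesis sh_even : all (fun a => ~~ odd a) sh.
Local Notation T := 'I_(2 * n).
Local Open Scope ring_scope.

Definition row_group : {group {perm T}} := level_group (fun x : T => rowof sh x).
Definition col_group : {group {perm T}} := level_group (fun x : T => colof sh x).

Definition youngv (f : mvec R n) : mvec R n := gsym false row_group (gsym true col_group f).

Definition base_vec : mvec R n := [ffun m => (m == base_matching n)%:R].

Lemma youngE (f : mvec R n) : youngv f = young sh f.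
Proof.
apply/ffunP => m; rewrite /youngv {1}/gsym sum_ffunE [RHS]ffunE.
apply: eq_big => [p|p _]; first by rewrite inE.
rewrite /= expr0 scale1r ffunE /gsym sum_ffunE.
apply: eq_big => [q|q _]; first by rewrite inE.
by rewrite !ffunE.
Qed.

(** The value at the base matching is the sum of the signs of [q] over the pairs [p], [q] for which
    [q * p] fixes that matching. Each such [q] keeps parity and commutes with [partner_ord], hence
    is even, and the identity pair makes the sum positive. *)
Lemma young_base_neq0 : youngv base_vec != 0.
Proof.
apply/eqP => /ffunP/(_ (base_matching n)); rewrite [RHS]ffunE.
rewrite /youngv {1}/gsym sum_ffunE; apply/eqP.
rewrite gt_eqF // (bigD1 1%g) ?group1 //=.
have term p : p \in row_group -> forall q, q \in col_group ->
    0 <= ((-1) ^+ odd_perm q *: pmact q base_vec) (mconj p^-1 (base_matching n)) :> R.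
  move=> /level_setP hp q /level_setP hq; rewrite !ffunE; case: eqP => [E|_]; last first.
    by rewrite /GRing.scale /= mulr0.
  suff -> : odd_perm q = false by rewrite expr0 scale1r.
  have {}E : val (base_matching n) = (val (base_matching n) ^ (q * p))%g.
    rewrite -{2}E mconjM val_mconj -conjgM -invMg.
    by rewrite mulVg conjg1.
  have com x : (q * p)%g (partner_ord x) = partner_ord ((q * p)%g x).
    by rewrite -!base_matchingE {2}E permJ.
  (* [p] keeps rows and [q * p] commutes with [partner_ord], so [q] puts partners into one row; as
     [q] also keeps columns, it sends partners to partners. *)
  have rowq x : rowof sh (q (partner_ord x)) = rowof sh (q x).
    have := hp (q (partner_ord x)); rewrite -permM com => <-.
    by have [-> _ _] := cell_partner ((q * p)%g x) sh_even; rewrite permM hp.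
  apply: even_perm_commute_base => x.
    by have [_ _ <-] := cell_partner (q x) sh_even; have [_ _ <-] := cell_partner x sh_even;
      rewrite hq.
  apply: val_inj; apply: (@cell_inj sh).
    by have [e _ _] := cell_partner (q x) sh_even; rewrite rowq -e.
  have [_ -> _] := cell_partner (q x) sh_even; rewrite !hq.
  by have [_ -> _] := cell_partner x sh_even.
apply: ltr_wpDr.
  apply: sumr_ge0 => p /andP[hp _]; rewrite expr0 scale1r ffunE /gsym sum_ffunE.
  by apply: sumr_ge0 => q hq; apply: term.
rewrite expr0 scale1r ffunE /gsym sum_ffunE (bigD1 1%g) ?group1 //=.
apply: ltr_wpDr; first by apply: sumr_ge0 => q /andP[hq _]; apply: term (group1 _) _ hq.
by rewrite odd_perm1 expr0 scale1r !ffunE !mconjM !invg1 !mulg1 mconj1 eqxx ltr01.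
Qed.

Definition anti_vec : mvec R n := gsym true col_group (youngv base_vec).

(** Let $r$, $c$ be the row symmetrizer and column antisymmetrizer, $v$ the base vector and
    $z=rcv\ne0$. From $\langle z,z\rangle\ne0$ follows $\langle z,cv\rangle=\langle
    cz,v\rangle\ne0$, so $cz\ne0$; from $\langle cz,cz\rangle\ne0$ follows $\langle
    cz,z\rangle=\langle rcz,cv\rangle\ne0$. *)
Lemma row_anti_neq0 : gsym false row_group anti_vec != 0.
Proof.
pose b := gsym true col_group base_vec; pose z := gsym false row_group b.
have z0 : dot z z != 0 by rewrite dot_eq0 young_base_neq0.
have y0 : anti_vec != 0.
  apply: contraNneq (gsym_neq0 z0) => y0.
  by rewrite -/z /b -gsym_adj [gsym true _ z]y0 dotC linear0.
have /gsym_neq0 : dot anti_vec anti_vec != 0 by rewrite dot_eq0.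
apply: contraNneq => e; rewrite -/anti_vec /youngv -gsym_adj e dotC.
by rewrite linear0.
Qed.

End Young.

(** * Garnir relations *)

Lemma tperm_commute (T : finType) (a b c d : T) : uniq [:: a; b; c; d] ->
  commute (tperm a b) (tperm c d).
Proof.
rewrite /= !inE !negb_or => /and4P[/and3P[_ ac ad] /andP[bc bd] _ _].
by apply/commgP/conjg_fixP; rewrite tpermJ !tpermD // eq_sym.
Qed.

Lemma tperm_commute_Sym (T : finType) (Z : {set T}) (p : {perm T}) (x y : T) :
  p \in Sym Z -> x \notin Z -> y \notin Z -> commute p (tperm x y).
Proof.
rewrite inE => pZ xZ yZ; apply/commute_sym/commgP/conjg_fixP.
by rewrite tpermJ !(out_perm pZ).
Qed.

Lemma tperm_Sym (T : finType) (Z : {set T}) (x y : T) :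
  x \in Z -> y \in Z -> tperm x y \in Sym Z.
Proof.
move=> xZ yZ; rewrite inE; apply/subsetP => z; rewrite inE.
by case: tpermP => [->|->|]; rewrite ?eqxx.
Qed.

Lemma mem_perm_imset (T : finType) (Z : {set T}) (g : {perm T}) z :
  (z \in g @: Z) = (g^-1%g z \in Z).
Proof. by rewrite -[in LHS](permKV g z) mem_imset //; apply: perm_inj. Qed.

Section Garnir.
Local Open Scope ring_scope.
Variables (R : realType) (n : nat).
Local Notation T := 'I_(2 * n).
Local Notation V := (mvec R n).
Local Notation symm Z := (gsym false (Sym Z)).
Implicit Types (f w : V) (Z : {set T}) (g p : {perm T}) (D L : seq (T * T)).

(** Coset decomposition: a permutation of [x |: Z] sending [x] to [y] is one of [Z] followed by the
    transposition of [x] and [y]. *)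
Lemma symm_setU1 Z x f : x \notin Z ->
  symm (x |: Z) f = symm Z f + \sum_(y in Z) pmact (tperm x y) (symm Z f).
Proof.
move=> xZ; rewrite {1}/gsym.
rewrite (partition_big (fun p : {perm T} => p x) [in x |: Z]) => [|p]; last first.
  by rewrite [p \in _]inE => pZ; rewrite perm_closed // !inE eqxx.
transitivity (\sum_(y in x |: Z) pmact (tperm x y) (symm Z f)); last first.
  by rewrite big_setU1 //= tperm1 pmact1.
apply: eq_bigr => y yZ; rewrite /gsym linear_sum /=.
rewrite (reindex_inj (mulIg (tperm x y))) /=.
have tin : tperm x y \in Sym (x |: Z) by rewrite tperm_Sym // !inE eqxx.
apply: eq_big => [p|p _]; last by rewrite linearZ /= pmactM.
rewrite (groupMr _ tin) permM (canF_eq (tpermK x y)) tpermR !inE.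
apply/andP/idP => [[pxZ /eqP px]|pZ].
  apply/subsetP => z zp; have := subsetP pxZ z zp; rewrite !inE => /orP[/eqP zx|//].
  by move: zp; rewrite inE zx px eqxx.
rewrite (out_perm pZ) //; split=> //.
by apply: subset_trans pZ _; apply: subsetUr.
Qed.

Variables (u : V) (Z : {set T}).
(** In the application [u] is an image of the Young symmetrizer and [Z] the first row: [u] is
    row-symmetric, and [#|Z|.+1] points exceed the number of columns. *)
Hypothesis u_sym : forall p, p \in Sym Z -> pmact p u = u.
Hypothesis u_ann : forall (Z' : {set T}) g, #|Z'| = #|Z|.+1 -> symm Z' (pmact g u) = 0.

Lemma pmact_img_inv g p : p \in Sym (g @: Z) -> pmact p (pmact g u) = pmact g u.
Proof.
move=> pg; rewrite pmactM -[(g * p)%g](mulgKV g) -pmactM u_sym //.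
rewrite inE; apply/subsetP => z; rewrite inE; apply: contraR => zZ.
move: pg; rewrite inE => pg; rewrite !permM (out_perm pg) ?permK //.
by rewrite mem_perm_imset permK.
Qed.

(** The symmetrizer of [x |: g @: Z] kills [pmact g u]. In its coset expansion the symmetrizer of
    [g @: Z] only multiplies by the order of the group. *)
Lemma garnir g x : x \notin g @: Z ->
  pmact g u + \sum_(y in g @: Z) pmact (tperm x y) (pmact g u) = 0.
Proof.
move=> xg; have := @u_ann (x |: g @: Z) g.
rewrite cardsU1 xg card_imset ?add1n; last exact: perm_inj.
move=> /(_ erefl); rewrite symm_setU1 // gsym_id => [|p /pmact_img_inv ->]; last by rewrite scale1r.
under eq_bigr do rewrite linearZ /=.
rewrite -scaler_sumr -scalerDr => /eqP; rewrite scaler_eq0 pnatr_eq0 => /orP[|/eqP //].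
by rewrite -leqn0 leqNgt cardG_gt0.
Qed.

(** Consing a pair applies its transposition after the others. *)
Fixpoint gprod D : {perm T} := if D is p :: D' then (gprod D' * tperm p.1 p.2)%g else 1%g.

Definition good_pairs D :=
  [&& uniq (unzip1 D), uniq (unzip2 D) & all (fun p : T * T => (p.1 \notin Z) && (p.2 \in Z)) D].

Lemma good_pairs_perm D L : perm_eq D L -> good_pairs D = good_pairs L.
Proof.
move=> pDL; rewrite /good_pairs (perm_uniq (perm_map fst pDL)).
by rewrite (perm_uniq (perm_map snd pDL)) (perm_all _ pDL).
Qed.

Lemma good_pairs_cons (p : T * T) D : good_pairs (p :: D) ->
  [/\ good_pairs D, p.1 \notin Z, p.2 \in Z, p.1 \notin unzip1 D & p.2 \notin unzip2 D].
Proof.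
by case/and3P => /= /andP[? ?] /andP[? ?] /andP[/andP[? ?] ?]; split=> //; apply/and3P.
Qed.

Lemma good_pairs_fst D z : good_pairs D -> z \in unzip1 D -> z \notin Z.
Proof. by case/and3P => _ _ /allP H /mapP[p /H/andP[pZ _] ->]. Qed.

Lemma mem_gprod D z : good_pairs D ->
  (z \in gprod D @: Z) = (z \in Z) && (z \notin unzip2 D) || (z \in unzip1 D).
Proof.
elim: D z => [|p D IH] z gD.
  by rewrite mem_perm_imset invg1 perm1 /= andbT orbF.
have [{}gD p1Z p2Z p1D p2D] := good_pairs_cons gD.
rewrite mem_perm_imset invMg permM tpermV -mem_perm_imset IH //= !inE.
case: tpermP => [->|->|/eqP z1 /eqP z2].
- by rewrite p2Z p2D eqxx orbT.
- rewrite eqxx (negbTE p1Z) (negbTE p1D) andbF /=; apply/esym/negbTE.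
  rewrite negb_or; apply/andP; split; first by apply: contraTneq p2Z => ->.
  by apply: contraTN p2Z => /(good_pairs_fst gD).
- by rewrite (negbTE z1) (negbTE z2).
Qed.

(** Induction on [D], symmetrizing over [Z] the Garnir relation for [p.1] and [g @: Z]. The [m]
    terms with [y] in [Z] all equal the new left-hand side; those with [y] among the earlier first
    entries extend the other symmetrizer by [p.1]. So each pair brings a minus sign and a positive
    factor $1/m$. *)
Lemma symm_gprod D : good_pairs D -> exists2 c : R, 0 < c &
  symm Z (pmact (gprod D) u) = ((-1) ^+ size D * c) *: symm [set z in unzip1 D] u.
Proof.
elim: D => [|p D IH] gpD.
  exists #|Sym Z|%:R; first by rewrite ltr0n cardG_gt0.
  rewrite /= pmact1 expr0 mul1r gsym_id => [|p /u_sym->]; last by rewrite scale1r.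
  congr (_ *: _); rewrite gsym_id => [|p]; rewrite ?set_nil.
    by rewrite card_Sym cards0 scale1r.
  rewrite inE => /perm_on_id->; rewrite ?pmact1 ?scale1r ?cards0 //.
have [gD p1Z p2Z p1D p2D] := good_pairs_cons gpD.
have [c c0 Ec] := IH gD; set g := gprod D in Ec.
have /garnir G : p.1 \notin g @: Z by rewrite mem_gprod // negb_or (negbTE p1Z).
pose m := #|[set y in g @: Z | y \in Z]|.
have m0 : 0 < m%:R :> R.
  by rewrite ltr0n card_gt0; apply/set0Pn; exists p.2; rewrite inE mem_gprod // p2Z p2D.
(* The transposition [s] of [y] and [p.2] fixes [pmact g u], is absorbed by the symmetrizer of [Z],
   and conjugates one transposition into the other. *)
have E1 y : y \in g @: Z -> y \in Z ->
    symm Z (pmact (tperm p.1 y) (pmact g u)) = symm Z (pmact (gprod (p :: D)) u).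
  move=> yg yZ; pose s := tperm y p.2.
  have sZ : s \in Sym Z by apply: tperm_Sym.
  have sg : s \in Sym (g @: Z) by rewrite tperm_Sym // mem_gprod // p2Z p2D.
  have -> : pmact (gprod (p :: D)) u = pmact s (pmact (tperm p.1 y) (pmact g u)).
    rewrite -[pmact g u in RHS](pmact_img_inv (groupVr sg)) !pmactM /= -/g.
    congr (pmact _ u); congr (g * _)%g.
    rewrite -[RHS]/(tperm p.1 y ^ s)%g tpermJ tpermL tpermD //.
      by apply: contraNneq p1Z => <-.
    by apply: contraNneq p1Z => <-.
  by rewrite [RHS]gsym_pmact //= expr0 scale1r.
(* Both [p.1] and [y] lie outside [Z], so their transposition commutes with [Sym Z]. *)
have E2 y : y \in unzip1 D ->
    symm Z (pmact (tperm p.1 y) (pmact g u)) = pmact (tperm p.1 y) (symm Z (pmact g u)).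
  move=> /(good_pairs_fst gD) yZ; rewrite /gsym linear_sum; apply: eq_bigr => q qZ /=.
  by rewrite !expr0 !scale1r pmactM [RHS]pmactM (tperm_commute_Sym qZ p1Z yZ).
have : m%:R *: symm Z (pmact (gprod (p :: D)) u)
   = - (symm Z (pmact g u) + \sum_(y in [set z in unzip1 D]) pmact (tperm p.1 y) (symm Z (pmact g u))).
  have := congr1 (symm Z) G; rewrite linearD linear0 linear_sum /=.
  rewrite (bigID (mem Z)) /= => /eqP; rewrite addrCA addr_eq0 => /eqP H.
  rewrite scaler_nat -[_ *+ m]sumr_const.
  rewrite (eq_bigl (fun y => (y \in g @: Z) && (y \in Z))) => [|y]; last by rewrite inE.
  rewrite -(eq_bigr _ (fun y (Hy : _ && _) => E1 y (proj1 (andP Hy)) (proj2 (andP Hy)))).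
  rewrite H; congr (- (_ + _)); apply: eq_big => [y|y].
    rewrite mem_gprod // inE; apply/andP/idP => [[/orP[/andP[-> //]|//]]|yD].
    by rewrite yD orbT (good_pairs_fst gD yD).
  move=> /andP[yg yZ]; apply: E2.
  by move: yg; rewrite mem_gprod // (negbTE yZ).
move=> Em; exists (c / m%:R); first by rewrite divr_gt0.
apply: (scalerI (lt0r_neq0 m0)); rewrite Em Ec.
under eq_bigr do rewrite linearZ /=.
rewrite -scaler_sumr -scalerDr -symm_setU1 ?inE // -set_cons scalerA -scaleNr.
by congr (_ *: _); rewrite exprS /=; field; apply: lt0r_neq0.
Qed.

(** With $g$ the product and $\sigma$ the symmetrizer of $Z$, $|Z|!\,\langle gu,u\rangle=\langle
    gu,\sigma u\rangle=\langle\sigma gu,u\rangle$, to which [symm_gprod] and [dot_gsym_ge0]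
    apply. *)
Lemma sign_gprod D : good_pairs D -> 0 <= (-1) ^+ size D * dot (pmact (gprod D) u) u.
Proof.
move=> gD; have [c c0 E] := symm_gprod gD.
have := @dot_gsym_ge0 R n false (Sym_group [set z in unzip1 D]) u.
rewrite -(pmulr_rge0 _ c0) -dotZl => H.
have N0 : 0 < #|Sym Z|%:R :> R by rewrite ltr0n cardG_gt0.
rewrite -(pmulr_rge0 _ N0) mulrCA -dotZr.
rewrite -(@gsym_id _ _ false (Sym_group Z) u) => [|p /u_sym->]; last by rewrite scale1r.
by rewrite -gsym_adj E dotZl mulrA mulrA -expr2 sqrr_sign mul1r -dotZl.
Qed.

End Garnir.

(** * Products of [1 + tau] and [1 - tau] over disjoint transpositions *)

(** [uniq (pts L)] says that the pairs of [L] are disjoint and consist of distinct points. *)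
Definition pts (T : Type) (L : seq (T * T)) : seq T := flatten [seq [:: p.1; p.2] | p <- L].

Lemma pts_cat (T : Type) (L1 L2 : seq (T * T)) : pts (L1 ++ L2) = pts L1 ++ pts L2.
Proof. by rewrite /pts map_cat flatten_cat. Qed.

Lemma mem_pts (T : eqType) (L : seq (T * T)) p : p \in L -> (p.1 \in pts L) && (p.2 \in pts L).
Proof.
move=> pL; apply/andP; split; apply/flattenP; exists [:: p.1; p.2];
  by rewrite ?inE ?eqxx ?orbT //; apply/mapP; exists p.
Qed.

Lemma pts_map (I T : eqType) (f g : I -> T) s :
  pts [seq (f i, g i) | i <- s] =i [seq f i | i <- s] ++ [seq g i | i <- s].
Proof.
move=> x; elim: s => //= i s; rewrite mem_cat !inE mem_cat => ->.
by rewrite inE; do ?case: (_ == _); case: (_ \in _).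
Qed.

Lemma uniq_pts_map (I T : eqType) (f g : I -> T) s : uniq s ->
  {in s &, injective f} -> {in s &, injective g} ->
  {in s &, forall i j, f i != g j} -> uniq (pts [seq (f i, g i) | i <- s]).
Proof.
elim: s => //= i s IH /andP[iS us] fi gi fg.
have sub j : j \in s -> j \in i :: s by rewrite inE orbC => ->.
have iin : i \in i :: s by rewrite inE eqxx.
rewrite -/(pts [seq (f i, g i) | i <- s]) !inE !pts_map !mem_cat (negbTE (fg _ _ iin iin)) /=.
rewrite IH // => [|j k /sub ? /sub ?|j k /sub ? /sub ?|j k /sub ? /sub ?]; [|exact: fi|exact: gi|exact: fg].
rewrite andbT !negb_or -!andbA; apply/and4P; split; apply/negP => /mapP[j js e].
- by move: iS; rewrite (fi _ _ iin (sub _ js) e) js.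
- by have := fg _ _ iin (sub _ js); rewrite e eqxx.
- by have := fg _ _ (sub _ js) iin; rewrite e eqxx.
- by move: iS; rewrite (gi _ _ iin (sub _ js) e) js.
Qed.

Lemma pts_commute (T : finType) (L1 L2 : seq (T * T)) p q : uniq (pts (L1 ++ L2)) ->
  p \in L1 -> q \in L2 -> commute (tperm p.1 p.2) (tperm q.1 q.2).
Proof.
rewrite pts_cat cat_uniq => /and3P[_ /hasPn H _] /mem_pts/andP[p1 p2] /mem_pts/andP[/H q1 /H q2].
have [->|np] := eqVneq p.1 p.2; first by rewrite tperm1; apply/commute_sym/commute1.
have [->|nq] := eqVneq q.1 q.2; first by rewrite tperm1; apply: commute1.
apply: tperm_commute; rewrite /= !inE !negb_or np nq !andbT /=.
rewrite -!andbA; apply/and4P; split.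
- by apply: contraNneq q1 => <-.
- by apply: contraNneq q2 => <-.
- by apply: contraNneq q1 => <-.
- by apply: contraNneq q2 => <-.
Qed.

Lemma uniq_pts_unzip (T : eqType) (L : seq (T * T)) : uniq (pts L) ->
  uniq (unzip1 L) && uniq (unzip2 L).
Proof.
elim: L => //= p L IH; rewrite -/(pts L) !inE negb_or => /and3P[/andP[_ p1] p2 /IH/andP[-> ->]].
rewrite !andbT; apply/andP; split; [apply: contra p1 | apply: contra p2];
  by case/mapP => q /mem_pts/andP[? ?] ->.
Qed.

Section FoldPairs.
Local Open Scope ring_scope.
Variables (R : realType) (n : nat).
Local Notation T := 'I_(2 * n).
Local Notation V := (mvec R n).
Implicit Types (f w u : V) (L D : seq (T * T)) (e : bool).

(** The product of the operators $1+(-1)^e\tau$ over the transpositions $\tau$ of [L]. *)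
Definition fold_pairs e L f : V :=
  foldl (fun w (p : T * T) => w + (-1) ^+ e *: pmact (tperm p.1 p.2) w) f L.

Fact fold_pairs_linear e L : linear (fold_pairs e L).
Proof.
elim: L => [|p L IH] a f w //=; rewrite -IH; congr (fold_pairs e L _).
by rewrite linearP scalerDr scalerA (mulrC _ a) -scalerA addrACA -scalerDr.
Qed.
HB.instance Definition _ e L :=
  GRing.isLinear.Build R V V *:%R (fold_pairs e L) (fold_pairs_linear e L).

Lemma pmact_fold_pairs e L h f :
  (forall p : T * T, p \in L -> commute h (tperm p.1 p.2)) ->
  pmact h (fold_pairs e L f) = fold_pairs e L (pmact h f).
Proof.
elim: L f => [|p L IH] f //= H.
rewrite IH => [|q qL]; last by apply: H; rewrite inE qL orbT.
by rewrite linearD linearZ /= !pmactM H // inE eqxx.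
Qed.

(** $\tau(1+\varepsilon\tau)=\varepsilon(1+\varepsilon\tau)$ for $\varepsilon=\pm1$, and disjoint
    transpositions commute. *)
Lemma fold_pairs_sign e L (p : T * T) f : uniq (pts L) -> p \in L ->
  pmact (tperm p.1 p.2) (fold_pairs e L f) = (-1) ^+ e *: fold_pairs e L f.
Proof.
elim: L f => [|q L IH] f // U; rewrite inE => /orP[/eqP->|pL] /=; last first.
  by apply: IH => //; move: U => /= /and3P[].
rewrite pmact_fold_pairs; last first.
  by move=> r rL; apply: (@pts_commute _ [:: q] L) => //; rewrite inE.
rewrite linearD linearZ /= pmactM tperm2 pmact1 -linearZ /= scalerDr scalerA.
by rewrite -signr_addb addbb expr0 scale1r addrC.
Qed.

Lemma gsym_fold_pairs (H : {group {perm T}}) L f :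
  (forall p : T * T, p \in L -> tperm p.1 p.2 \in H) ->
  gsym false H (fold_pairs false L f) = (2 ^ size L)%:R *: gsym false H f.
Proof.
elim: L f => [|p L IH] f HL /=; first by rewrite scale1r.
rewrite IH => [|q qL]; last by apply: HL; rewrite inE qL orbT.
rewrite expr0 scale1r [gsym _ _ (f + _)]linearD /= gsym_pmact /=; last by apply: HL; rewrite inE eqxx.
by rewrite expr0 scale1r -mulr2n -scaler_nat scalerA -natrM mulnC -expnS.
Qed.

Section Nonzero.
Variables (u : V) (Z : {set T}).
Hypothesis u_sym : forall p, p \in Sym Z -> pmact p u = u.
Hypothesis u_ann : forall (Z' : {set T}) g, #|Z'| = #|Z|.+1 ->
  gsym false (Sym Z') (pmact g u) = 0.

(** Every term in the expansion of the product of the $1-\tau$ is covered by [sign_gprod]; [D]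
    collects the transpositions already chosen. *)
Lemma fold_pairs_dot_ge0 L D : good_pairs Z (D ++ L) ->
  0 <= (-1) ^+ size D * dot (fold_pairs true L (pmact (gprod D) u)) u.
Proof.
elim: L D => [|p L IH] D; first by rewrite cats0; apply: sign_gprod.
have pc : perm_eq (D ++ p :: L) (p :: D ++ L).
  exact: etrans (perm_catCA D [:: p] L _) (perm_refl _).
rewrite (good_pairs_perm _ pc) /= => gD.
rewrite linearD expr1 scaleN1r linearN dotDl mulrDr addr_ge0 //.
  by apply: IH; have [] := good_pairs_cons gD.
by rewrite -scaleN1r dotZl mulrA -exprSr pmactM; apply: (IH (p :: D)).
Qed.

(** The term without any transposition is $\langle u,u\rangle>0$; the others are nonnegative. *)
Lemma fold_pairs_neq0 L : u != 0 -> good_pairs Z L -> fold_pairs true L u != 0.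
Proof.
move=> u0 gL; suff : 0 < dot (fold_pairs true L u) u.
  by apply: contraTneq => ->; rewrite dotC linear0 ltxx.
elim: L gL => [|p L IH] gpL; first by rewrite /= dot_gt0.
have [gL _ _ _ _] := good_pairs_cons gpL.
rewrite /= linearD expr1 scaleN1r linearN dotDl ltr_wpDr ?IH //.
have := @fold_pairs_dot_ge0 L [:: p] gpL.
by rewrite /= mul1g expr1 -scaleN1r dotZl.
Qed.

End Nonzero.
End FoldPairs.

(** * Vectors with prescribed symmetries *)

Lemma rowof_start sh r j : r < size sh -> j < nth 0 sh r ->
  rowof sh (sumn (take r sh) + j) = r /\ colof sh (sumn (take r sh) + j) = j.
Proof.
elim: sh r => [|a sh IH] [|r] //= rs js; first by rewrite add0n js.
have [e1 e2] := IH r rs js.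
have -> : a + sumn (take r sh) + j < a = false by [lia].
by rewrite -addnA addKn e1 e2.
Qed.

Lemma start_lt sh r j : r < size sh -> j < nth 0 sh r ->
  sumn (take r sh) + j < sumn sh.
Proof. by elim: sh r => [|a sh IH] [|r] //= rs js; [|have := IH r rs js]; lia. Qed.

Section Config.
Variables (R : realType) (n : nat).
Local Notation T := 'I_(2 * n).
Local Notation V := (mvec R n).
Implicit Types (f w u : V) (W : V -> Prop) (L : seq (T * T)).
Local Open Scope ring_scope.

Definition stable W := (forall a f w, W f -> W w -> W (a *: f + w)) /\
  (forall g f, W f -> W (pmact g f)).

Lemma stable_sum W I (r : seq I) (P : pred I) (F : I -> V) : stable W -> W 0 ->
  (forall i, P i -> W (F i)) -> W (\sum_(i <- r | P i) F i).
Proof.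
move=> [WD _] W0 WF; elim/big_ind: _ => // f w Wf Ww.
by rewrite -[f]scale1r; apply: WD.
Qed.

Lemma stable_gsym W e (H : {set {perm T}}) f : stable W -> W f -> W (gsym e H f).
Proof.
move=> sW Wf; have [WD WA] := sW.
have W0 : W 0 by rewrite -(addNr f) -scaleN1r; apply: WD.
apply: stable_sum => // p _; rewrite -[_ *: _]addr0; apply: WD => //; exact: WA.
Qed.

Lemma stable_fold_pairs W e L f : stable W -> W f -> W (fold_pairs e L f).
Proof.
move=> [WD WA]; elim: L f => //= p L IH f Wf.
by apply: IH; rewrite addrC; apply: WD => //; apply: WA.
Qed.

Definition config W k := exists w L1 L2,
  [/\ W w /\ w != 0, size L1 = k /\ size L2 = k, uniq (pts (L1 ++ L2)),
    forall p : T * T, p \in L1 -> pmact (tperm p.1 p.2) w = - w &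
    forall p : T * T, p \in L2 -> pmact (tperm p.1 p.2) w = w].

Variables (sh : seq nat) (k : nat).
Hypotheses (sh_even : all (fun a => ~~ odd a) sh) (sh_pos : all (leq 1) sh)
  (sh_sorted : sorted geq sh) (sh_sum : sumn sh = (2 * n)%N).
Variable W : V -> Prop.
Hypotheses (sW : stable W) (W_young : forall f, W (youngv sh f)).

(* More points than columns: two of them lie in the same column. *)
Lemma Sym_col_eq0 (Z : {set T}) g f : (head 0%N sh < #|Z|)%N ->
  gsym false (Sym Z) (pmact g (gsym true (col_group n sh) f)) = 0.
Proof.
move=> hZ; pose c (x : T) := colof sh (g^-1%g x).
have cl x : (c x < head 0%N sh)%N.
  apply: colof_lt; last by rewrite sh_sum.
  by case: (sh) sh_sorted => //= a s /(order_path_min (rev_trans leq_trans)) ->; rewrite /= leqnn.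
have /dinjectivePn[x xZ [y yZ xy]] : ~~ dinjectiveb (fun x => Ordinal (cl x)) (mem Z).
  apply: contraL hZ => /dinjectiveP inj; rewrite -leqNgt.
  by rewrite -(card_in_imset inj) -[leqRHS]card_ord max_card.
move: xy => /(congr1 val) /= cxy; have {yZ}[yx yZ] : y != x /\ y \in Z.
  by move: yZ; rewrite inE => /andP[].
pose s := tperm (g^-1%g x) (g^-1%g y).
have sC : s \in col_group n sh by apply: tperm_level.
have e : pmact (tperm x y) (pmact g (gsym true (col_group n sh) f))
    = - pmact g (gsym true (col_group n sh) f).
  have -> : tperm x y = (s ^ g)%g by rewrite tpermJ !permKV.
  rewrite pmactM conjgE mulKVg -pmactM pmact_gsym //= odd_tperm.
  by rewrite (inj_eq perm_inj) eq_sym yx expr1 scaleN1r linearN.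
have := gsym_pmact false (pmact g (gsym true (col_group n sh) f)) (tperm_Sym xZ yZ).
rewrite e linearN /= expr0 scale1r => /eqP; rewrite eq_sym -subr_eq0 opprK -mulr2n -scaler_nat.
by rewrite scaler_eq0 pnatr_eq0 => /eqP.
Qed.

(** The first row has room for the [k] points $y_i$ and for [k] further disjoint pairs, symmetric
    because [u] is; the $x_i$ are the first [k] cells below it. *)
Lemma config_wide : (3 * k <= head 0 sh)%N -> (head 0 sh + k <= 2 * n)%N ->
  (0 < n)%N -> config W k.
Proof.
set a := head 0%N sh => ka ak n0.
have n20 : (0 < 2 * n)%N by lia.
(* All indices used stay below [2 * n], so the default is never taken. *)
pose o i : T := insubd (Ordinal n20) i.
have oE i : (i < 2 * n)%N -> val (o i) = i by move=> i2; rewrite val_insubd i2.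
pose Z := [set x : T | (x < a)%N].
pose L1 := [seq (o (a + i)%N, o i) | i <- iota 0 k].
pose L2 := [seq (o (k + 2 * i)%N, o (k + 2 * i + 1)%N) | i <- iota 0 k].
pose u : V := youngv sh (base_vec R n).
have it i : i \in iota 0 k -> (i < k)%N by rewrite mem_iota.
have neq i j : (i < 2 * n)%N -> (j < 2 * n)%N -> i != j -> o i != o j.
  by move=> i2 j2; apply: contraNneq => /(congr1 val); rewrite !oE // => ->.
have injo i j : (i < 2 * n)%N -> (j < 2 * n)%N -> o i = o j -> i = j.
  by move=> i2 j2 /(congr1 val); rewrite !oE.
have U1 : uniq (pts L1).
  apply: uniq_pts_map; rewrite ?iota_uniq // => i j /it ik /it jk.
  - by move/injo; lia.
  - by move/injo; lia.
  - by apply: neq; lia.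
have U2 : uniq (pts L2).
  apply: uniq_pts_map; rewrite ?iota_uniq // => i j /it ik /it jk.
  - by move/injo; lia.
  - by move/injo; lia.
  - by apply: neq; lia.
have L2Z x : x \in pts L2 -> (k <= x < a)%N.
  by rewrite pts_map mem_cat => /orP[] /mapP[i /it ik ->]; rewrite oE; lia.
have U : uniq (pts (L1 ++ L2)).
  rewrite pts_cat cat_uniq U1 U2 andbT /=; apply/hasPn => x /L2Z xa.
  apply/negP; rewrite pts_map mem_cat => /orP[] /mapP[i /it ik e];
    by move: xa; rewrite e oE; lia.
have row0 i : (i < a)%N -> rowof sh i = 0%N.
  by rewrite /a; case: (sh) => //= b s ->.
have u_sym p : p \in Sym Z -> pmact p u = u.
  move=> pZ; rewrite /u /youngv pmact_gsym /= ?expr0 ?scale1r //.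
  apply/level_setP => x; have [xZ|xZ] := boolP (x \in Z).
    have pxZ : p x \in Z by move: pZ; rewrite inE => pZ; rewrite perm_closed.
    by move: xZ pxZ; rewrite !inE => xa pxa; rewrite !row0.
  by move: pZ; rewrite inE => pZ; rewrite (out_perm pZ).
have cZ : #|Z| = a.
  have aN : (a <= 2 * n)%N by lia.
  have -> : Z = [set widen_ord aN i | i : 'I_a].
    apply/setP => x; rewrite inE; apply/idP/imsetP => [xa|[i _ ->] /=]; last exact: ltn_ord.
    by exists (Ordinal xa) => //; apply: val_inj.
  by rewrite card_imset ?card_ord // => i j /(congr1 val) /= /val_inj.
have u_ann (Z' : {set T}) g : #|Z'| = #|Z|.+1 -> gsym false (Sym Z') (pmact g u) = 0.
  (* [u] is a sum of translates of a column-antisymmetric vector, and [Z'] has more points than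
     there are columns. *)
  move=> cZ'; rewrite /u /youngv {2}/gsym !linear_sum big1 // => p _.
  rewrite !linearZ /= pmactM Sym_col_eq0 ?scaler0 //.
  by rewrite cZ' cZ.
have gL : good_pairs Z L1.
  apply/and3P; have /andP[-> ->] := uniq_pts_unzip U1; split=> //.
  by apply/allP => p /mapP[i /it ik ->] /=; rewrite !inE !oE; lia.
exists (fold_pairs true L1 u), L1, L2; split.
- split; first by apply: stable_fold_pairs => //; apply: W_young.
  by apply: fold_pairs_neq0 u_sym u_ann _ _ gL; apply: young_base_neq0.
- by rewrite !size_map size_iota.
- exact: U.
- by move=> p pL; rewrite fold_pairs_sign // expr1 scaleN1r.
- move=> p pL; rewrite pmact_fold_pairs => [|q qL].
    have /andP[/L2Z p1 /L2Z p2] := mem_pts pL.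
    rewrite u_sym // tperm_Sym // inE.
      by case/andP: p1.
    by case/andP: p2.
  by apply/commute_sym/(pts_commute U).
Qed.

(** Each row has at least two cells. The first [2 * k] rows are paired along the first column; each
    of the next [k] rows gives the pair of its first two cells. *)
Lemma config_tall : (3 * k <= size sh)%N -> (0 < n)%N -> config W k.
Proof.
move=> ks n0; have n20 : (0 < 2 * n)%N by lia.
pose o i : T := insubd (Ordinal n20) i.
pose c r := sumn (take r sh).
have rowlen r : (r < size sh)%N -> (1 < nth 0 sh r)%N.
  move=> rs; have /allP/(_ _ (mem_nth 0%N rs)) := sh_pos.
  by have /allP/(_ _ (mem_nth 0%N rs)) := sh_even; case: nth => [|[]].
have oE r j : (r < size sh)%N -> (j < 2)%N -> val (o (c r + j)%N) = (c r + j)%N.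
  move=> rs j2; rewrite val_insubd ifT // -sh_sum start_lt //.
  exact: leq_trans (rowlen r rs).
have cellE r j : (r < size sh)%N -> (j < 2)%N ->
    rowof sh (o (c r + j)%N) = r /\ colof sh (o (c r + j)%N) = j.
  move=> rs j2; have H := rowof_start rs (leq_trans j2 (rowlen r rs)).
  by rewrite -/(c r) -(oE r j rs j2) in H.
have injo r j r' j' : (r < size sh)%N -> (j < 2)%N -> (r' < size sh)%N -> (j' < 2)%N ->
    o (c r + j)%N = o (c r' + j')%N -> r = r' /\ j = j'.
  move=> rs j2 rs' j2' e; have [a1 a2] := cellE r j rs j2.
  by have [e1 e2] := cellE r' j' rs' j2'; split; [rewrite -a1 e | rewrite -a2 e].
pose L1 := [seq (o (c (2 * i) + 0)%N, o (c (2 * i + 1) + 0)%N) | i <- iota 0 k].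
pose L2 := [seq (o (c (2 * k + i) + 0)%N, o (c (2 * k + i) + 1)%N) | i <- iota 0 k].
have it i : i \in iota 0 k -> (i < k)%N by rewrite mem_iota.
have U1 : uniq (pts L1).
  apply: uniq_pts_map; rewrite ?iota_uniq // => i j /it ik /it jk.
  - by move/injo; lia.
  - by move/injo; lia.
  - by apply/eqP => /injo; lia.
have U2 : uniq (pts L2).
  apply: uniq_pts_map; rewrite ?iota_uniq // => i j /it ik /it jk.
  - by move/injo; lia.
  - by move/injo; lia.
  - by apply/eqP => /injo; lia.
have U : uniq (pts (L1 ++ L2)).
  rewrite pts_cat cat_uniq U1 U2 andbT /=; apply/hasPn => x.
  rewrite pts_map mem_cat => /orP[] /mapP[i /it ik ->]; apply/negP;
    by rewrite pts_map mem_cat => /orP[] /mapP[j /it jk] /injo; lia.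
have ycol (p : T * T) : p \in L1 -> pmact (tperm p.1 p.2) (anti_vec R n sh) = - anti_vec R n sh.
  move=> /mapP[i /it ik ->] /=; rewrite pmact_gsym /=.
    rewrite odd_tperm (_ : (_ != _) = true) ?expr1 ?scaleN1r //.
    by apply/eqP => /injo; lia.
  apply: tperm_level.
  have [||_ ->] := cellE (2 * i)%N 0%N; [lia|by []|].
  by have [||_ ->] := cellE (2 * i + 1)%N 0%N; [lia|by []|].
have prow (p : T * T) : p \in L2 -> tperm p.1 p.2 \in row_group n sh.
  move=> /mapP[i /it ik ->] /=; apply: tperm_level.
  have [||-> _] := cellE (2 * k + i)%N 0%N; [lia|by []|].
  by have [||-> _] := cellE (2 * k + i)%N 1%N; [lia|by []|].
exists (fold_pairs false L2 (anti_vec R n sh)), L1, L2; split.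
- split; first by apply: stable_fold_pairs => //; apply: stable_gsym => //; apply: W_young.
  (* The row symmetrizer takes this vector to $2^k$ times its value on [anti_vec], which is
     nonzero. *)
  have := row_anti_neq0 R n sh_even; apply: contraNneq => e.
  have := gsym_fold_pairs (anti_vec R n sh) prow; rewrite e linear0 => /esym/eqP.
  by rewrite scaler_eq0 pnatr_eq0 expn_eq0.
- by rewrite !size_map size_iota.
- exact: U.
- move=> p pL; rewrite pmact_fold_pairs => [|q qL]; first by rewrite ycol // linearN.
  exact: pts_commute U _ _.
- move=> p pL; rewrite fold_pairs_sign ?expr0 ?scale1r //.
Qed.

End Config.

(** * Orthogonal families *)

Lemma leq_bin_mid n a b : a <= b -> 2 * b <= n -> 'C(n, a) <= 'C(n, b).
Proof.
move=> /subnK <-; elim: (b - a) => // d IH; rewrite addSn => bn.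
apply: leq_trans (IH _) _; first by lia.
rewrite -(leq_pmul2l (ltn0Sn (d + a))) mul_bin_left leq_mul2r; apply/orP; right; lia.
Qed.

(** $\binom na\ge\binom nk$, and each of the [k] factors $n-i$ of $k!\binom nk$ is at least $n/2$
    because $2k\le n$. *)
Lemma expn_le_bin n k a : k <= a -> k <= n - a -> 0 < k ->
  n ^ k <= 2 ^ k * k`! * 'C(n, a).
Proof.
move=> ka kna k0; apply: (@leq_trans (2 ^ k * k`! * 'C(n, k))).
  rewrite -mulnA (mulnC k`!) bin_ffact ffact_prod.
  rewrite -[X in _ <= _ ^ X * _](card_ord k) -prod_nat_const -big_split /=.
  rewrite -[X in _ ^ X <= _](card_ord k) -prod_nat_const.
  by apply: leq_prod => i _; have := ltn_ord i; lia.
rewrite leq_mul2l; apply/orP; right.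
have [a2|a2] := leqP (2 * a) n; first exact: leq_bin_mid.
by rewrite -(@bin_sub n a); [apply: leq_bin_mid; lia | lia].
Qed.

Lemma perm_ext (T : finType) (s1 s2 : seq T) : uniq s1 -> uniq s2 -> size s1 = size s2 ->
  exists g : {perm T}, map g s1 = s2.
Proof.
elim: s1 s2 => [|x s1 IH] [|y s2] //=; first by exists 1%g.
move=> /andP[xs u1] /andP[ys u2] [/(IH _ u1 u2)[g gs]].
exists (g * tperm (g x) y)%g; rewrite permM tpermL; congr (_ :: _).
rewrite -gs; apply/eq_in_map => z zs; rewrite permM tpermD //.
  by apply: contraNneq xs => /perm_inj->.
by apply: contraNneq ys => ->; rewrite -gs map_f.
Qed.

Definition perm_pair (T : finType) (g : {perm T}) (p : T * T) := (g p.1, g p.2).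

Lemma pts_inj (T : Type) : injective (@pts T).
Proof.
by elim=> [|[a b] L IH] [|[c d] L'] //= [-> -> /IH->].
Qed.

Lemma pairs_ext (T : finType) (L1 L2 : seq (T * T)) :
  uniq (pts L1) -> uniq (pts L2) -> size L1 = size L2 ->
  exists g : {perm T}, map (perm_pair g) L1 = L2.
Proof.
have sz (L : seq (T * T)) : size (pts L) = (size L).*2.
  by elim: L => //= p L; rewrite -/(pts L) doubleS => ->.
move=> u1 u2 e; have [|g gE] := perm_ext u1 u2; first by rewrite !sz e.
exists g; apply: pts_inj; rewrite -gE.
by elim: (L1) => //= p L IH; congr [:: _, _ & _]; apply: IH.
Qed.

(** * Sign vectors for the pairs $(2i,2i+1)$, and Bessel's inequality *)

Section Family.
Variables (R : realType) (n : nat).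
Local Notation T := 'I_(2 * n).
Local Notation V := (mvec R n).
Implicit Types (f w u : V) (W : V -> Prop) (A C D : {set 'I_n}).
Local Open Scope ring_scope.

Fact edge_subproof (i : 'I_n) : ((2 * i < 2 * n) && ((2 * i).+1 < 2 * n))%N.
Proof. by have := ltn_ord i; lia. Qed.

Definition edge (i : 'I_n) : T * T :=
  (Ordinal (proj1 (andP (edge_subproof i))), Ordinal (proj2 (andP (edge_subproof i)))).

Definition edge_perm (i : 'I_n) : {perm T} := tperm (edge i).1 (edge i).2.

Lemma uniq_pts_edge (s : seq 'I_n) : uniq s -> uniq (pts [seq edge i | i <- s]).
Proof.
move=> us; rewrite (eq_map (_ : edge =1 (fun i => ((edge i).1, (edge i).2)))) => [|[]//].
apply: uniq_pts_map => // i j _ _.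
- by move=> /(congr1 val) /= e; apply: ord_inj; lia.
- by move=> /(congr1 val) /= e; apply: ord_inj; lia.
- by rewrite -val_eqE /=; lia.
Qed.

Lemma edge_perm_commute i j : commute (edge_perm i) (edge_perm j).
Proof.
have [->|ij] := eqVneq i j; first exact: commute_refl.
apply: (@pts_commute _ [:: edge i] [:: edge j]); rewrite ?inE //.
by apply: (@uniq_pts_edge [:: i; j]); rewrite /= inE ij.
Qed.

Lemma pmact_perm_pair g (p : T * T) w :
  pmact (tperm (perm_pair g p).1 (perm_pair g p).2) (pmact g w) = pmact g (pmact (tperm p.1 p.2) w).
Proof. by rewrite !pmactM /= -tpermJ conjgE !mulgA mulgV mul1g. Qed.

Lemma pmact_neq0 g w : w != 0 -> pmact g w != 0.
Proof. by apply: contraNneq => e; rewrite -(pmactK g w) e linear0. Qed.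

Lemma neq_opp w : w != 0 -> - w != w.
Proof.
apply: contraNneq => /eqP; rewrite eq_sym -subr_eq0 opprK -mulr2n -scaler_nat.
by rewrite scaler_eq0 pnatr_eq0.
Qed.

(** One edge at a time: either $u+\tau u$ is nonzero and fixed by $\tau$, or $\tau u=-u$ already.
    Edge transpositions commute, so earlier signs persist. *)
Lemma edge_signs W (r : seq 'I_n) w : stable W -> W w -> w != 0 -> exists2 w',
  W w' /\ w' != 0 &
  (forall i, i \in r -> pmact (edge_perm i) w' = w' \/ pmact (edge_perm i) w' = - w') /\
  (forall i, (pmact (edge_perm i) w = w -> pmact (edge_perm i) w' = w') /\
     (pmact (edge_perm i) w = - w -> pmact (edge_perm i) w' = - w')).
Proof.
move=> [WD WA] Ww w0; elim: r => [|j r [u [Wu u0] [ur uk]]]; first by exists w.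
have [e|ne] := eqVneq (u + pmact (edge_perm j) u) 0.
  exists u => //; split=> // i; rewrite inE => /orP[/eqP->|/ur//]; right.
  by apply/eqP; rewrite -addr_eq0 addrC e.
have C i (e : bool) : pmact (edge_perm i) u = (-1) ^+ e *: u ->
    pmact (edge_perm i) (u + pmact (edge_perm j) u) = (-1) ^+ e *: (u + pmact (edge_perm j) u).
  by move=> H; rewrite linearD /= pmactM -edge_perm_commute -pmactM H linearZ scalerDr.
have C0 i : pmact (edge_perm i) u = u ->
    pmact (edge_perm i) (u + pmact (edge_perm j) u) = u + pmact (edge_perm j) u.
  by move=> H; have := C i false; rewrite expr0 !scale1r; apply.
have C1 i : pmact (edge_perm i) u = - u ->
    pmact (edge_perm i) (u + pmact (edge_perm j) u) = - (u + pmact (edge_perm j) u).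
  by move=> H; have := C i true; rewrite expr1 !scaleN1r; apply.
exists (u + pmact (edge_perm j) u).
  by split=> //; rewrite addrC -[pmact _ _]scale1r; apply: WD => //; apply: WA.
split=> [i|i]; last by have [u1 u2] := uk i; split=> [/u1/C0|/u2/C1].
rewrite inE => /orP[/eqP->|/ur[/C0|/C1]]; [left | by left | by right].
by rewrite linearD /= pmactM tperm2 pmact1 addrC.
Qed.

(** A translation moves the configuration onto the first [2 * k] edges. Refining the signs keeps [k]
    of these inside [A] and [k] outside. *)
Lemma config_edge_signs W k : stable W -> config W k -> exists w A,
  [/\ W w /\ w != 0, (k <= #|A|)%N /\ (k <= n - #|A|)%N,
    forall i, i \in A -> pmact (edge_perm i) w = - w &
    forall i, i \notin A -> pmact (edge_perm i) w = w].
Proof.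
move=> sW [w [L1 [L2 [[Ww w0] [s1 s2] U an sy]]]].
have kn : (2 * k <= n)%N.
  have := max_card (mem (pts (L1 ++ L2))); rewrite (card_uniqP U) card_ord.
  have -> : size (pts (L1 ++ L2)) = (size (L1 ++ L2)).*2.
    by elim: (L1 ++ L2) => //= p L; rewrite -/(pts L) doubleS => ->.
  by rewrite size_cat s1 s2; lia.
pose Lc := [seq edge i | i <- take (2 * k) (enum 'I_n)].
have [||g gL] := @pairs_ext _ (L1 ++ L2) Lc U.
- by apply: uniq_pts_edge; rewrite take_uniq ?enum_uniq.
- by rewrite size_cat s1 s2 size_map size_takel ?size_enum_ord; lia.
have edgeE (i : 'I_n) : (i < 2 * k)%N -> edge i = nth (edge i) (map (perm_pair g) (L1 ++ L2)) i.
  move=> ik; rewrite gL (nth_map i) ?size_takel ?size_enum_ord //.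
  by rewrite nth_take // nth_ord_enum.
have [w' [Ww' w'0] [sg keep]] := edge_signs (enum 'I_n) sW (sW.2 g _ Ww) (pmact_neq0 g w0).
pose A := [set i | pmact (edge_perm i) w' != w'].
have low (i : 'I_n) : (i < k)%N -> i \in A.
  move=> ik; rewrite inE; have -> : pmact (edge_perm i) w' = - w'; last exact: neq_opp.
  apply: (keep i).2; have : edge i \in map (perm_pair g) L1.
    rewrite edgeE ?map_cat; last by lia.
    by rewrite nth_cat size_map s1 ik mem_nth // size_map s1.
  case/mapP => p pL e; rewrite /edge_perm e pmact_perm_pair an //.
  by rewrite linearN.
have high (i : 'I_n) : (k <= i < 2 * k)%N -> i \notin A.
  move=> /andP[ki ik]; rewrite inE negbK; apply/eqP.
  apply: (keep i).1; have : edge i \in map (perm_pair g) L2.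
    rewrite edgeE // map_cat.
    rewrite nth_cat size_map s1 ltnNge ki /= mem_nth // size_map s2; lia.
  by case/mapP => p pL e; rewrite /edge_perm e pmact_perm_pair sy.
exists w', A; split => //; last 1 first.
- by move=> i; rewrite inE negbK => /eqP.
- have k1 : (k <= n)%N by lia.
  have inj1 : injective (fun i : 'I_k => widen_ord k1 i) by move=> i j /(congr1 val) /= /val_inj.
  have k2 (i : 'I_k) : (k + i < n)%N by have := ltn_ord i; lia.
  have inj2 : injective (fun i : 'I_k => Ordinal (k2 i)).
    by move=> i j /(congr1 val) /= /addnI /val_inj.
  split.
    rewrite -[leqLHS](card_ord k) -(card_imset _ inj1); apply/subset_leq_card/subsetP.
    by move=> _ /imsetP[i _ ->]; apply: low => /=.
  have <- : #|~: A| = (n - #|A|)%N by rewrite cardsCs setCK card_ord.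
  rewrite -[leqLHS](card_ord k) -(card_imset _ inj2); apply/subset_leq_card/subsetP.
  by move=> _ /imsetP[i _ ->]; rewrite inE; apply: high => /=; have := ltn_ord i; lia.
- by move=> i; rewrite inE => iA; have [||e] := sg i; rewrite ?mem_enum // => e; rewrite e eqxx in iA.
Qed.

(** A permutation carrying the edges of [A] to those of [C] translates [w] to a vector with pattern
    [C]. For distinct patterns of equal size, the transposition of an edge in one only shows that
    the inner product is its own negative. *)
Lemma orthogonal_family W w A : stable W -> W w -> w != 0 ->
  (forall i, i \in A -> pmact (edge_perm i) w = - w) ->
  (forall i, i \notin A -> pmact (edge_perm i) w = w) ->
  exists F : {set 'I_n} -> V,
    (forall C, #|C| = #|A| -> W (F C) /\ F C != 0) /\
    (forall C D, #|C| = #|A| -> #|D| = #|A| -> C != D -> dot (F C) (F D) = 0).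
Proof.
move=> sW Ww w0 an sy.
have /fin_all_exists[F HF] : forall C : {set 'I_n}, exists v, #|C| = #|A| ->
    [/\ W v /\ v != 0, forall i, i \in C -> pmact (edge_perm i) v = - v &
        forall i, i \notin C -> pmact (edge_perm i) v = v].
  move=> C; have [cC|ne] := eqVneq #|C| #|A|; last by exists 0 => e; rewrite e eqxx in ne.
  have enumU (D : {set 'I_n}) : uniq (enum D ++ enum (~: D)).
    rewrite cat_uniq !enum_uniq andbT; apply/hasPn => i.
    by rewrite !mem_enum inE.
  have sz (D : {set 'I_n}) : size (enum D ++ enum (~: D)) = n.
    by rewrite size_cat -!cardE cardsC card_ord.
  have [|g] := pairs_ext (uniq_pts_edge (enumU A)) (uniq_pts_edge (enumU C)).
    by rewrite !size_map !sz.
  rewrite !map_cat => /eqP; rewrite eqseq_cat ?size_map -?cardE // => /andP[/eqP gA /eqP gC].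
  exists (pmact g w) => _; split.
  - by split; [apply: sW.2 | apply: pmact_neq0].
  - move=> i iC; have : edge i \in [seq edge i | i <- enum C] by rewrite map_f ?mem_enum.
    rewrite -gA => /mapP[_ /mapP[j jA ->] e]; rewrite /edge_perm e pmact_perm_pair.
    by rewrite an ?linearN //; rewrite mem_enum in jA.
  - move=> i iC; have : edge i \in [seq edge i | i <- enum (~: C)] by rewrite map_f ?mem_enum ?inE.
    rewrite -gC => /mapP[_ /mapP[j jA ->] e]; rewrite /edge_perm e pmact_perm_pair.
    by rewrite sy //; rewrite mem_enum inE in jA.
exists F; split=> [C /HF[]//|C D cC cD CD].
have [[_ _] C1 C2] := HF C cC; have [[_ _] D1 D2] := HF D cD.
have [i iC iD] : exists2 i, i \in C & i \notin D.
  apply/subsetPn; apply: contra CD => sub; rewrite eqEcard sub.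
  by rewrite cC cD leqnn.
apply/eqP; have := dot_pmact (edge_perm i) (F C) (F D); rewrite C1 // D2 // -scaleN1r dotZl mulN1r.
by move/eqP; rewrite eq_sym -subr_eq0 opprK -mulr2n mulrn_eq0.
Qed.

Lemma bessel (J : finType) (P : pred J) (F : J -> V) f :
  (forall i, P i -> F i != 0) ->
  (forall i j, P i -> P j -> i != j -> dot (F i) (F j) = 0) ->
  \sum_(i | P i) dot f (F i) ^+ 2 / dot (F i) (F i) <= dot f f.
Proof.
move=> F0 orth; pose c i := dot f (F i) / dot (F i) (F i).
pose g : V := \sum_(i | P i) c i *: F i.
have fg : dot f g = \sum_(i | P i) dot f (F i) ^+ 2 / dot (F i) (F i).
  rewrite dot_sumr; apply: eq_bigr => i _; rewrite dotZr /c; ring.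
have gg : dot g g = dot f g.
  rewrite [in LHS]/g dot_suml fg; apply: eq_bigr => i Pi; rewrite dotZl dot_sumr.
  rewrite (bigD1 i) //= big1 => [|j /andP[Pj ji]]; last by rewrite dotZr orth ?mulr0 // eq_sym.
  rewrite addr0 dotZr /c; have : dot (F i) (F i) != 0 by rewrite dot_eq0 F0.
  by move=> H; field.
have := dot_ge0 (f - g); rewrite -fg -scaleN1r dotDr !dotDl !dotZr !dotZl gg (dotC g f).
by move=> H; lra.
Qed.

(** Row [m] of [t] has inner product [eta * F i m] with [F i]. Summing Bessel's inequality over [m],
    each [i] contributes exactly $\eta^2$. *)
Lemma eigen_bound (J : finType) (P : pred J) (F : J -> V) (t : matching n -> matching n -> R) (eta : R) :
  (forall i, P i -> F i != 0) ->
  (forall i j, P i -> P j -> i != j -> dot (F i) (F j) = 0) ->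
  (forall i m, P i -> \sum_m' t m m' * F i m' = eta * F i m) ->
  #|P|%:R * eta ^+ 2 <= \sum_m \sum_m' t m m' ^+ 2.
Proof.
move=> F0 orth eig; pose row m : V := [ffun m' => t m m'].
have H m : \sum_(i | P i) (eta * F i m) ^+ 2 / dot (F i) (F i) <= \sum_m' t m m' ^+ 2.
  have -> : \sum_m' t m m' ^+ 2 = dot (row m) (row m).
    by apply: eq_bigr => m' _; rewrite ffunE expr2.
  apply: le_trans (bessel (row m) F0 orth); rewrite le_eqVlt; apply/orP; left; apply/eqP.
  apply: eq_bigr => i Pi; rewrite -eig //; congr (_ ^+ 2 / _).
  by apply: eq_bigr => m' _; rewrite ffunE.
apply: le_trans (ler_sum _ (fun m _ => H m)); rewrite exchange_big /=.
rewrite (eq_bigr (fun=> eta ^+ 2)) => [|i Pi].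
  by rewrite sumr_const mulr_natl.
have D : dot (F i) (F i) != 0 by rewrite dot_eq0 F0.
rewrite -mulr_suml; have -> : \sum_m (eta * F i m) ^+ 2 = eta ^+ 2 * dot (F i) (F i).
  by rewrite mulr_sumr; apply: eq_bigr => m _; rewrite exprMn -expr2.
by rewrite mulfK.
Qed.

End Family.

(** * The eigenvalue bound *)

(* [Defs.double] multiplies with the semiring operations of [nat]. *)
Lemma doubleE mu : Defs.double mu = [seq 2 * a | a <- mu].
Proof. by []. Qed.

Lemma double_even mu : all (fun a => ~~ odd a) (Defs.double mu).
Proof. by rewrite doubleE all_map; apply/allP => a _ /=; rewrite mul2n odd_double. Qed.

Lemma double_pos mu : all (leq 1) mu -> all (leq 1) (Defs.double mu).
Proof. by rewrite doubleE all_map => /allP H; apply/allP => a /H /=; lia. Qed.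

Lemma double_sorted mu : sorted geq mu -> sorted geq (Defs.double mu).
Proof. by rewrite doubleE sorted_map; apply: sub_sorted => a b /=; rewrite leq_mul2l. Qed.

Lemma sumn_double mu : sumn (Defs.double mu) = 2 * sumn mu.
Proof. by rewrite doubleE; elim: mu => //= a s ->; rewrite mulnDr. Qed.

Lemma head_double mu : head 0 (Defs.double mu) = 2 * head 0 mu.
Proof. by rewrite doubleE; case: mu. Qed.

Lemma sumn_sorted_le mu : sorted geq mu -> sumn mu <= size mu * head 0 mu.
Proof.
case: mu => //= a s /(order_path_min (rev_trans leq_trans)) H.
rewrite mulSn leq_add2l; elim: s H => //= b s IH /andP[ba /IH{}IH].
by rewrite mulSn leq_add.
Qed.

(* The first summand makes the bound trivial for [n < 9 k^2], where there may be too few cells. *)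
Definition dim_const k := (9 * k * k) ^ k + 2 ^ k * k`!.

(** * Orthogonal vectors in the component of a partition that is not fat *)

Section Component.
Variables (R : realType) (n : nat) (mu : seq nat).
Local Notation V := (mvec R n).
Local Open Scope ring_scope.

Definition component (w : V) : Prop := @in_component R n mu w.

Lemma componentP (w : V) :
  component w <-> exists v : {perm 'I_(2 * n)} -> V,
    w = \sum_g pmact g (youngv (Defs.double mu) (v g)).
Proof.
have E v : \sum_g pmact g (youngv (Defs.double mu) (v g)) =
    [ffun m => \sum_g pact g (young (Defs.double mu) (v g)) m] :> V.
  by apply/ffunP => m; rewrite sum_ffunE ffunE; apply: eq_bigr => g _; rewrite youngE.
split=> -[v Hv]; exists v; first by rewrite E; apply/ffunP => m; rewrite ffunE.
by move=> m; rewrite Hv E ffunE.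
Qed.

Lemma component_stable : stable component.
Proof.
split=> [a f w /componentP[v ->] /componentP[v' ->]|h w /componentP[v ->]]; apply/componentP.
  exists (fun g => a *: v g + v' g); rewrite scaler_sumr -big_split.
  by apply: eq_bigr => g _; rewrite /youngv !linearP.
exists (fun g => v (g * h^-1)%g); rewrite linear_sum /= [RHS](reindex_inj (mulIg h)) /=.
by apply: eq_bigr => g _; rewrite mulgK pmactM.
Qed.

Lemma component_young f : component (youngv (Defs.double mu) f).
Proof.
apply/componentP; exists (fun g => if g == 1%g then f else 0).
rewrite (bigD1 1%g) //= eqxx pmact1 big1 ?addr0 // => g /negbTE->.
by rewrite /youngv !linear0.
Qed.

Lemma component_large t : (2 * t < n)%N -> mu \in partitions n -> ~~ fat n t mu ->
  exists (P : pred {set 'I_n}) (F : {set 'I_n} -> V),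
  [/\ forall C, P C -> component (F C) /\ F C != 0,
      forall C D, P C -> P D -> C != D -> dot (F C) (F D) = 0 &
      (n ^ (2 * t + 2) <= dim_const (2 * t + 2) * #|P|)%N].
Proof.
set k := (2 * t + 2)%N => tn muP nf.
have pmu := mem_partitions muP; have [srt pos /eqP sm] := and3P pmu.
have [small|large] := ltnP n (9 * k * k).
  exists (pred1 set0), (fun=> youngv (Defs.double mu) (base_vec R n)); split.
  - by move=> C _; split; [apply: component_young | apply: young_base_neq0 (double_even mu)].
  - by move=> C D /eqP-> /eqP->; rewrite eqxx.
  - rewrite card1 muln1; apply: leq_trans (leq_addr _ _).
    by rewrite leq_exp2r ?(ltnW small) // /k addn2.
have conf : config component k.
  have ev := double_even mu; have ps := double_pos pos; have ss := double_sorted srt.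
  have sd : sumn (Defs.double mu) = (2 * n)%N by rewrite sumn_double sm.
  (* The first part is at most $n-t-1$, so the doubled diagram has at least $2t+2$ cells below its
     first row; hence the value of [k]. *)
  have hd : (head 0 mu < n - t)%N by apply: not_fat_head muP nf; lia.
  have [wide|narrow] := leqP (3 * k) (head 0%N (Defs.double mu)).
    apply: config_wide component_stable component_young wide _ _ => //.
      by rewrite head_double; lia.
    by lia.
  apply: config_tall component_stable component_young _ _ => //; last by lia.
  (* With fewer than $3k$ rows and a first part below $3k$, [n] would be at most $(3k-1)^2$. *)
  rewrite doubleE size_map leqNgt; apply/negP => sz; have := sumn_sorted_le srt.
  rewrite sm; rewrite head_double in narrow.
  have : (size mu * head 0 mu <= (3 * k).-1 * (3 * k).-1)%N.
    by apply: leq_mul; lia.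
  have k0 : (0 < k)%N by rewrite /k addn2.
  by move: large k0; clear; nia.
have [w [A [[Ww w0] [kA kA'] an sy]]] := config_edge_signs component_stable conf.
have [F [F1 F2]] := orthogonal_family component_stable Ww w0 an sy.
exists [pred C : {set 'I_n} | #|C| == #|A|], F; split.
- by move=> C /eqP; apply: F1.
- by move=> C D /eqP cC /eqP cD; apply: F2.
- have -> : #|[pred C : {set 'I_n} | #|C| == #|A|]| = 'C(n, #|A|).
    by have := card_draws 'I_n #|A|; rewrite card_ord cardsE.
  apply: leq_trans (expn_le_bin kA kA' _) _; first by rewrite /k addn2.
  by rewrite leq_mul2r leq_addl orbT.
Qed.

End Component.

(** * Final estimates *)

Local Open Scope ring_scope.

(** $|\zeta|=1/(Q-1)$ with $1<Q\le(2n)^t$, as each of the [t] factors of [Q] is at most $2n$. *)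
Lemma zeta_lower (R : realType) n t : (0 < t)%N -> (2 * t < n)%N ->
  1 <= `|zeta R n t| * (2 * n)%:R ^+ t.
Proof.
move=> t0 tn; set Q := (\prod_(1 <= k < t.+1) (2 * n - 2 * k + 1))%N.
have Qle : (Q <= (2 * n) ^ t)%N.
  have -> : ((2 * n) ^ t = \prod_(1 <= k < t.+1) (2 * n))%N.
    by rewrite prod_nat_const_nat subSS subn0.
  rewrite /Q big_nat_cond [leqRHS]big_nat_cond; apply: leq_prod => k.
  by rewrite andbT => /andP[k1 kt]; lia.
have Q1 : (1 < Q)%N.
  rewrite /Q big_ltn // (@leq_trans ((2 * n - 2 * 1 + 1) * 1)) //; first by lia.
  by rewrite leq_mul2l prodn_gt0 ?orbT // => k; lia.
have Q1R : 1 < Q%:R :> R by rewrite ltr1n.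
have -> : `|zeta R n t| = (Q%:R - 1)^-1.
  by rewrite /zeta normrN ger0_norm // invr_ge0 subr_ge0 ltW.
rewrite mulrC ler_pdivlMr ?subr_gt0 // mul1r -natrX.
by rewrite lerBlDr (le_trans (_ : _ <= ((2 * n) ^ t)%:R)) ?ler_nat // lerDl.
Qed.

(** At most one $\rho^{(j)}$ is the cycle type of a given pair, so an entry is a single $x_j$ or
    zero, and is nonzero only if there is a long cycle; [card_big_comp] counts these in each row. *)
Lemma frobenius_bound (R : realType) n t (tn : (2 * t < n)%N) (b : R)
    (x : 'I_(Ft n t).-1 -> R) : 0 <= b -> (forall j, `|x j| <= b) ->
  \sum_(m : matching n) \sum_(m' : matching n)
      (\sum_j x j * (dtype m m' == part_nth n j)%:R) ^+ 2
    <= b ^+ 2 * (odfact n * ((2 * t).+1 * (odfact t.+1 * dfact2 n.-1)))%:R.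
Proof.
move=> b0 xb; pose big m := [set s | has (fun c => (n - t <= c)%N) (@dtype n m s)].
have jF (j : 'I_(Ft n t).-1) : (j < Ft n t)%N by have := ltn_ord j; lia.
have ent m m' : (\sum_j x j * (dtype m m' == part_nth n j)%:R) ^+ 2 <= b ^+ 2 * (m' \in big m)%:R.
  have [[j /eqP e]|no] := altP (@existsP _ (fun j : 'I_(Ft n t).-1 => dtype m m' == part_nth n j)).
    rewrite (bigD1 j) //= big1 => [|i ij]; last first.
      rewrite e; case: eqP => [/(part_nth_inj (jF j) (jF i)) ji|]; last by rewrite mulr0.
      by case/eqP: ij; apply: ord_inj.
    rewrite addr0 e eqxx inE e (fat_has (fat_part_nth (jF j))) !mulr1.
    by rewrite -[leLHS]real_normK ?num_real // lerXn2r ?nnegrE.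
  rewrite big1 => [|j _]; first by rewrite expr0n mulr_ge0 ?exprn_ge0.
  by move: no; rewrite negb_exists => /forallP/(_ j)/negbTE->; rewrite mulr0.
apply: (@le_trans _ _ (\sum_(m : matching n) b ^+ 2 * #|big m|%:R)).
  apply: ler_sum => m _; apply: le_trans (ler_sum _ (fun m' _ => ent m m')) _.
  by rewrite -mulr_sumr -natr_sum -sum1_card [in leRHS]big_mkcond.
rewrite -mulr_sumr ler_wpM2l ?exprn_ge0 // -natr_sum ler_nat.
apply: leq_trans (leq_sum _ (fun m _ => card_big_comp m tn)) _.
by rewrite sum_nat_const leq_mul2r card_matching orbT.
Qed.

Theorem mainTheorem5 (R : realType) (t : nat) (B : R) (hB : 0 < B) :
  exists G : R, 0 < G /\
  forall (n : nat), (2 * t < n)%N ->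
  forall P : seq nat -> seq nat -> R, is_eigen_table n P ->
  forall x : 'I_(Ft n t).-1 -> R,
    (forall j, `|x j| <= B / (dfact2 n.-1)%:R) ->
    (forall i : 'I_(Ft n t).-1,
        \sum_j x j * P (part_nth n i) (part_nth n j)
        = (if val i == 0%N then 1 else zeta R n t)) ->
    forall mu, mu \in partitions n -> ~~ fat n t mu ->
      `|\sum_j x j * P mu (part_nth n j)|
        <= G * `|zeta R n t| / Num.sqrt (n%:R).
Proof.
pose K := ((2 * t).+1 * odfact t.+1)%N.
pose C : R := B ^+ 2 * (2 * K * dim_const (2 * t + 2))%:R.
have C0 : 0 <= C by rewrite mulr_ge0 ?sqr_ge0 ?ler0n.
(* The factor $2^t$ comes from [zeta_lower], and $1+C$ dominates $\sqrt C$. *)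
exists (2 ^+ t * (1 + C)); split.
  by rewrite mulr_gt0 ?exprn_gt0 ?ltr0n // ltr_wpDr.
move=> n tn P eigP x xb _ mu muP nf.
have [t0|t0] := posnP t.
  rewrite big1 => [|j _]; first by rewrite normr0 t0 !mulr_ge0 ?invr_ge0 ?sqrtr_ge0 ?addr_ge0.
  by have := ltn_ord j; have := Ft0 (leq_ltn_trans (leq0n _) tn); rewrite -[in Ft n 0]t0; lia.
set eta := \sum_j _; set b := B / (dfact2 n.-1)%:R in xb.
have d0 : 0 < (dfact2 n.-1)%:R :> R by rewrite ltr0n dfact2_gt0.
have b0 : 0 <= b by rewrite divr_ge0 ?ltW.
have [Q [F [FW orth big]]] := component_large R tn muP nf.
pose A (m m' : matching n) : R := \sum_j x j * (dtype m m' == part_nth n j)%:R.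
have eig i m : Q i -> \sum_m' A m m' * F i m' = eta * F i m.
  move=> Qi; rewrite /A /eta mulr_suml; under eq_bigr do rewrite mulr_suml.
  rewrite exchange_big; apply: eq_bigr => j _ /=.
  have jF : (j < Ft n t)%N by have := ltn_ord j; lia.
  rewrite -mulrA -(eigP _ _ muP (part_nth_mem jF) _ (FW i Qi).1) ffunE mulr_sumr [RHS]big_mkcond.
  by apply: eq_bigr => m' _; case: eqP => _; rewrite ?mulr1 // mulr0 mul0r.
have := eigen_bound (fun i Qi => (FW i Qi).2) orth eig.
move=> /le_trans/(_ (frobenius_bound tn b0 xb)) E.
(* $(2n-1)!!\le2n\,(2n-2)!!$; the resulting square of $(2n-2)!!$ cancels the denominator of
   [b ^+ 2], leaving $O(n)$. *)
have nat_le : (odfact n * ((2 * t).+1 * (odfact t.+1 * dfact2 n.-1))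
    <= 2 * n * K * (dfact2 n.-1 * dfact2 n.-1))%N.
  have o : (odfact n <= dfact2 n.-1 * (2 * n))%N.
    have {1}-> : n = n.-1.+1 by lia.
    by rewrite odfactS leq_mul ?odfact_le_dfact2 //; lia.
  apply: leq_trans (leq_mul o (leqnn _)) _; rewrite /K.
  by apply: eq_leq; ring.
have Db : b ^+ 2 * (dfact2 n.-1 * dfact2 n.-1)%:R = B ^+ 2.
  by rewrite natrM /b; field; apply: lt0r_neq0.
have {}E : #|Q|%:R * eta ^+ 2 <= B ^+ 2 * (2 * n * K)%:R.
  apply: le_trans E _; rewrite -Db -mulrA ler_wpM2l ?exprn_ge0 //.
  by rewrite -natrM ler_nat [leqRHS]mulnC.
have n0 : (0 < n)%N by lia.
have nR : 0 < n%:R :> R by rewrite ltr0n.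
(* Thus $\eta^2=O(n^{-2t-1})$, that is $|\eta|=O(n^{-t}/\sqrt n)$, while $|\zeta|\ge(2n)^{-t}$. *)
have Cn : n%:R ^+ (2 * t + 2) * eta ^+ 2 <= C * n%:R.
  apply: (@le_trans _ _ ((dim_const (2 * t + 2) * #|Q|)%:R * eta ^+ 2)).
    by rewrite ler_wpM2r ?sqr_ge0 // -natrX ler_nat.
  have -> : C * n%:R = (dim_const (2 * t + 2))%:R * (B ^+ 2 * (2 * n * K)%:R).
    by rewrite /C !natrM; ring.
  by rewrite natrM -mulrA ler_wpM2l.
have {}Cn : (`|eta| * Num.sqrt n%:R * n%:R ^+ t) ^+ 2 <= C.
  rewrite !exprMn real_normK ?num_real // sqr_sqrtr ?ler0n // -(ler_pM2r nR).
  apply: le_trans Cn; rewrite le_eqVlt; apply/orP; left; apply/eqP.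
  by rewrite mulnC exprD exprM; ring.
have zl := zeta_lower R t0 tn.
rewrite ler_pdivlMr ?sqrtr_gt0 // -(ler_pM2r (exprn_gt0 t nR)).
have S : `|eta| * Num.sqrt n%:R * n%:R ^+ t <= 1 + C.
  have S0 : 0 <= `|eta| * Num.sqrt n%:R * n%:R ^+ t by rewrite !mulr_ge0 ?normr_ge0 ?sqrtr_ge0 ?exprn_ge0 ?ler0n.
  by move: Cn S0; set v := _ * _; nra.
apply: le_trans S _; rewrite natrM exprMn in zl.
have -> : 2 ^+ t * (1 + C) * `|zeta R n t| * n%:R ^+ t
   = (1 + C) * (`|zeta R n t| * (2 ^+ t * n%:R ^+ t)) by ring.
by rewrite ler_peMr // addr_ge0.
Qed.
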